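(* Let $h(z)=\sum_{k=0}^{\infty}a_k z^k$ be an analytic function on $|z|<r$ whose Taylor series about $0$ has radius of convergence $r$. Let $f$ be a positive function in the Wiener class on $[-\pi,\pi]$ such that $f_{\max}<r$. For each $n\ge 1$ let $A_n\in\mathbb{C}^{n\times n}$ be the Toeplitz matrix generated by $f$ and let $S_n\in\mathbb{C}^{n\times n}$ be Strang's circulant preconditioner for $A_n$. If $\|h(S_n)^{-1}\|_2$ is uniformly bounded with respect to $n$, then $|h(S_n)|^{-1}h(A_n)$ has clustered spectrum around $\pm1$ for sufficiently large $n$; that is, for any $\epsilon>0$ there exist positive integers $M$ and $N$ such that for all $n>N$ at most $M$ eigenvalues $\lambda$ of $|h(S_n)|^{-1}h(A_n)$ satisfy both $|\lambda-1|>\epsilon$ and $|\lambda+1|>\epsilon$.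
   Context: The Fourier coefficients of $f$ on $[-\pi,\pi]$ (extended $2\pi$-periodically) are $\hat f_k=\frac{1}{2\pi}\int_{-\pi}^{\pi}f(x)e^{-\mathbf{i}kx}\,dx$, $k\in\mathbb{Z}$. The function $f$ is in the Wiener class if $\sum_{k\in\mathbb{Z}}|\hat f_k|<\infty$ (so $f$ is continuous and equals the sum of its Fourier series). ''Positive'' means real-valued with $f(x)>0$ for all $x$; $f_{\max}$ is the maximum of $f$. The Toeplitz matrix generated by $f$ is $A_n=[\hat f_{j-k}]_{j,k=0}^{n-1}$; it is Hermitian positive definite for all $n$. Strang's circulant preconditioner $S_n$ for $A_n$ (standard definition) is the circulant matrix $[s_{(j-k)\bmod n}]_{j,k=0}^{n-1}$ obtained by copying the central diagonals of $A_n$: $s_k=\hat f_k$ for $0\le k<n/2$, $s_k=\hat f_{k-n}$ for $n/2<k\le n-1$, and, if $n$ is even, $s_{n/2}=\frac12(\hat f_{n/2}+\hat f_{-n/2})$. It is Hermitian. Matrix functions are defined by the power series: $h(X)=\sum_{k=0}^\infty a_kX^k$ for a matrix $X$ of spectral radius less than $r$; here $r\in(0,\infty]$, and $h(S_n)$ is so defined for all sufficiently large $n$. The Fourier matrix $U_n$ has entries $[U_n]_{jk}=\frac{1}{\sqrt n}e^{-2\pi\mathbf{i}jk/n}$, $0\le j,k\le n-1$. For a circulant $C_n=U_n^*\Omega_nU_n$ ($\Omega_n$ diagonal), the absolute value circulant matrix is $|C_n|=(C_n^*C_n)^{1/2}=U_n^*|\Omega_n|U_n$, where $|\Omega_n|$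 is $\Omega_n$ with every entry replaced by its modulus; this defines $|h(S_n)|$. $\|\cdot\|_2$ is the spectral norm. Uniform boundedness of $\|h(S_n)^{-1}\|_2$ means that $h(S_n)$ is nonsingular for every $n$ for which it is defined and there is a constant $c_0$ independent of $n$ with $\|h(S_n)^{-1}\|_2<c_0$. Eigenvalues are counted with multiplicity.
   Formalization: The Taylor coefficients a_k of h are assumed real; for complex coefficients the claim fails, e.g. h(z)=i gives |h(S_n)|^{-1}h(A_n)=iI, whose n eigenvalues are all at distance √2 from both 1 and -1. *)

(* Defs.v *)
From HB Require Import structures.
From mathcomp Require Import all_boot all_order all_algebra.
From mathcomp Require Import all_classical all_reals all_analysis.
From mathcomp Require Import complex.
Set Implicit Arguments.
Unset Strict Implicit.
Unset Printing Implicit Defensive.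
Import Order.TTheory GRing.Theory Num.Theory.
Import numFieldNormedType.Exports.
Import Normc.

Local Open Scope classical_set_scope.
Local Open Scope complex_scope.
Local Open Scope sesquilinear_scope.
Local Open Scope ring_scope.

(* [normc z : R] is the library's real-valued modulus of [z : R[i]]. *)

Definition expi {R : realType} (t : R) : R[i] := cos t +i* sin t.

(* Limits in C, taken on real and imaginary parts. *)
Definition ccvg_to {R : realType} (u : nat -> R[i]) (l : R[i]) : Prop :=
  (fun n => complex.Re (u n)) @ \oo --> complex.Re l /\ (fun n => complex.Im (u n)) @ \oo --> complex.Im l.

Definition clim {R : realType} (u : nat -> R[i]) : R[i] :=
  limn (fun n => complex.Re (u n)) +i* limn (fun n => complex.Im (u n)).

Definition cintegral {R : realType} (D : set R) (g : R -> R[i]) : R[i] :=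
  (\int[lebesgue_measure]_(x in D) complex.Re (g x)) +i*
  (\int[lebesgue_measure]_(x in D) complex.Im (g x)).

Definition psum {R : realType} (a : nat -> R[i]) (z : R[i]) (N : nat) : R[i] :=
  \sum_(k < N) a k * z ^+ k.

Definition power_series_on {R : realType} (h : R[i] -> R[i]) (a : nat -> R[i])
    (r : \bar R) : Prop :=
  forall z : R[i], ((normc z)%:E < r)%E -> ccvg_to (psum a z) (h z).

Definition convergence_radius {R : realType} (a : nat -> R[i]) : \bar R :=
  ereal_sup [set (normc z)%:E | z in [set z | exists l, ccvg_to (psum a z) l]].

Definition fourier {R : realType} (f : R -> R) (k : int) : R[i] :=
  ((2 * pi)^-1)%:C *
  cintegral `[- pi, pi] (fun x => (f x)%:C * expi (- (k%:~R * x))).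

(* Summability of the coefficients determines [f] only almost everywhere; the
   continuous 2pi-periodic representative is the one meant. *)
Definition wiener {R : realType} (f : R -> R) : Prop :=
  [/\ continuous f, periodic f (2 * pi) &
      summable [set: int] (fun k => (normc (fourier f k))%:E)].

Definition fmax {R : realType} (f : R -> R) : R := sup (f @` `[- pi, pi]).

Definition toeplitz {R : realType} (f : R -> R) (n : nat) : 'M[R[i]]_n :=
  \matrix_(j, k) fourier f (j%:Z - k%:Z).

Definition strang_coef {R : realType} (f : R -> R) (n k : nat) : R[i] :=
  if (k.*2 < n)%N then fourier f k%:Z
  else if (n < k.*2)%N then fourier f (k%:Z - n%:Z)
  else (fourier f k%:Z + fourier f (- k%:Z)) / 2.

(* [j + n - k] is [j - k] mod [n] without truncation, as [k < n]. *)
Definition strang {R : realType} (f : R -> R) (n : nat) : 'M[R[i]]_n :=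
  \matrix_(j, k) strang_coef f n ((j + n - k) %% n)%N.

(* The roots of the characteristic polynomial, repeated with multiplicity. *)
Definition eigenvalues {R : realType} (n : nat) (X : 'M[R[i]]_n) : seq R[i] :=
  sval (closed_field_poly_normal (char_poly X)).

Definition spectral_radius {R : realType} (n : nat) (X : 'M[R[i]]_n) : R :=
  \big[Num.max/0]_(l <- eigenvalues X) normc l.

(* Meaningful when [spectral_radius X < convergence_radius a]. *)
Definition matfun {R : realType} (a : nat -> R[i]) (n : nat) (X : 'M[R[i]]_n) :
    'M[R[i]]_n :=
  \matrix_(i, j) clim (fun N => (\sum_(k < N) a k *: X ^+ k) i j).

Definition fourier_mx (R : realType) (n : nat) : 'M[R[i]]_n :=
  \matrix_(j, k) (((Num.sqrt n%:R)^-1)%:C *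
                  expi (- (2 * pi * j%:R * k%:R / n%:R))).

(* U^* |Omega| U, where Omega = U C U^* is diagonal when C is circulant. *)
Definition abs_circulant {R : realType} (n : nat) (C : 'M[R[i]]_n) :
    'M[R[i]]_n :=
  let U := fourier_mx R n in
  U ^t* *m map_mx (fun z : R[i] => `|z|) (U *m C *m U ^t*) *m U.

Definition vnorm2 {R : realType} (n : nat) (v : 'cV[R[i]]_n) : R :=
  Num.sqrt (\sum_i normc (v i 0) ^+ 2).

Definition spectral_norm {R : realType} (n : nat) (X : 'M[R[i]]_n) : R :=
  sup [set vnorm2 (X *m v) | v in [set v : 'cV[R[i]]_n | vnorm2 v = 1]].

Definition num_outliers {R : realType} (eps : R) (n : nat) (X : 'M[R[i]]_n) :
    nat :=
  count (fun l : R[i] => (eps < normc (l - 1)) && (eps < normc (l + 1)))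
    (eigenvalues X).

(* Main.v *)
Require Import Defs.
From HB Require Import structures.
From mathcomp Require Import all_boot all_order all_algebra.
From mathcomp Require Import all_classical all_reals all_analysis.
From mathcomp Require Import complex.
From mathcomp Require Import zify ring lra.
Set Implicit Arguments.
Unset Strict Implicit.
Unset Printing Implicit Defensive.
Import Order.TTheory GRing.Theory Num.Theory.
Import numFieldNormedType.Exports.
Import Normc.
Local Open Scope classical_set_scope.
Local Open Scope complex_scope.
Local Open Scope sesquilinear_scope.
Local Open Scope ring_scope.

(** Write S, A for the circulant and the Toeplitz matrix of order n and put
    G = |h(S)|^(-1/2), a Hermitian function of S.  The preconditioned matrix
    |h(S)|^(-1) h(A) = G G h(A) is similar to the Hermitian matrix
    H = G h(A) G, and Q = G h(S) G = sign(h(S)) is a Hermitian involution,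
    because the coefficients of h are real and S is Hermitian.  So H should be
    compared with Q, and the eigenvalues of H away from 1 and -1 are those that
    make H^2 - 1 large.

    The comparison uses families of matrices that are, for every epsilon,
    eventually the sum of a matrix of norm at most epsilon and a matrix of
    bounded rank (here [essentially_small]).  They form a two-sided ideal among
    the families of bounded norm, closed under uniform approximation.  Three
    facts then give the theorem.

    - A - S is essentially small ([toeplitz_strang_essentially_small]).  Away
      from its first N rows and columns every entry of A - S involves only
      Fourier coefficients of index larger than N, whose absolute sum is small;
      Schur's test bounds that part, and the rows and columns left out have rank
      at most 2N.
    - Hence p(A) - p(S) is essentially small for every polynomial p, and so is
      h(A) - h(S) ([esmall_matfun_sub]), since the Taylor polynomials converge
      to h uniformly on a disc of radius rho < r containing both spectra.  It
      follows that H - Q = G (h(A) - h(S)) G and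
      H^2 - 1 = H (H - Q) + (H - Q) Q are essentially small.
    - If H^2 - 1 = E + L with E small, then no nonzero vector of the span of
      the eigenvectors with outlying eigenvalues is killed by L, so that the
      number of outliers is at most the rank of L
      ([outliers_of_essentially_small]).

    The spectra are located by Rayleigh quotients.  The quadratic form of A at v
    is the mean of f times the squared modulus of a trigonometric polynomial
    whose own mean square is the norm of v, which puts the eigenvalues of A in
    [0, fmax f] ([toeplitz_rayleigh]).  An eigenvalue of S is the Rayleigh
    quotient of S at a column of the Fourier matrix; all coordinates of that
    vector have modulus n^(-1/2), so replacing S by A costs at most the mean
    absolute row sum of A - S, which tends to 0 ([strang_eig_le]). *)

(** * Operator bounds through squared norms *)

Section Operators.
Context {C : numClosedFieldType}.

Definition sqn n (v : 'rV[C]_n) : C := \sum_i `|v 0 i| ^+ 2.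

Lemma sqn_ge0 n (v : 'rV[C]_n) : 0 <= sqn v.
Proof. by apply: sumr_ge0 => i _; rewrite exprn_ge0. Qed.

Lemma sqnE n (v : 'rV[C]_n) : sqn v = (v *m v ^t*) 0 0.
Proof. by rewrite mxE; apply: eq_bigr => i _; rewrite !mxE normCK. Qed.

Lemma normD_sqr (x y : C) : `|x + y| ^+ 2 <= 2 * (`|x| ^+ 2 + `|y| ^+ 2).
Proof.
apply: (@le_trans _ _ ((`|x| + `|y|) ^+ 2)).
  by rewrite lerXn2r ?nnegrE ?addr_ge0 ?ler_normD.
rewrite -subr_ge0.
rewrite (_ : _ - _ = (`|x| - `|y|) ^+ 2); last by ring.
by rewrite real_exprn_even_ge0 // realB ?normr_real.
Qed.

Lemma sqnD n (u v : 'rV[C]_n) : sqn (u + v) <= 2 * (sqn u + sqn v).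
Proof.
rewrite -big_split mulr_sumr; apply: ler_sum => i _.
by rewrite mxE normD_sqr.
Qed.

Lemma sqn_unitary n (v : 'rV[C]_n) (P : 'M[C]_n) :
  P \is unitarymx -> sqn (v *m P) = sqn v.
Proof. by move=> uP; rewrite !sqnE trmx_mul map_mxM mulmxA mulmxtVK. Qed.

Lemma sqnZ n (v : 'rV[C]_n) a : sqn (a *: v) = `|a| ^+ 2 * sqn v.
Proof.
by rewrite mulr_sumr; apply: eq_bigr => i _; rewrite mxE normrM exprMn.
Qed.

(** The constant bounds the square of the operator norm, and matrices act on row
    vectors.  In terms of squared norms a sum costs a factor 2, which is harmless
    in all the estimates below. *)
Definition opnorm_sq_le n (X : 'M[C]_n) (c : C) :=
  forall v, sqn (v *m X) <= c * sqn v.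

Lemma opnorm_sq_leW n (X : 'M[C]_n) c d :
  c <= d -> opnorm_sq_le X c -> opnorm_sq_le X d.
Proof.
by move=> cd Xc v; apply: le_trans (Xc v) _; rewrite ler_wpM2r ?sqn_ge0.
Qed.

Lemma opnorm_sq_leD n (X Y : 'M[C]_n) c d :
  opnorm_sq_le X c -> opnorm_sq_le Y d -> opnorm_sq_le (X + Y) (2 * (c + d)).
Proof.
move=> Xc Yd v; rewrite mulmxDr; apply: le_trans (sqnD _ _) _.
by rewrite -mulrA ler_wpM2l ?ler0n // mulrDl lerD.
Qed.

Lemma opnorm_sq_leM n (X Y : 'M[C]_n) c d :
  0 <= d -> opnorm_sq_le X c -> opnorm_sq_le Y d -> opnorm_sq_le (X *m Y) (c * d).
Proof.
move=> d0 Xc Yd v; rewrite mulmxA; apply: le_trans (Yd _) _.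
by rewrite mulrAC [leRHS]mulrC ler_wpM2l.
Qed.

Lemma opnorm_sq_leZ n (X : 'M[C]_n) c a :
  opnorm_sq_le X c -> opnorm_sq_le (a *: X) (`|a| ^+ 2 * c).
Proof.
by move=> Xc v; rewrite -scalemxAr sqnZ -[leRHS]mulrA ler_wpM2l ?exprn_ge0.
Qed.

Lemma opnorm_sq_leN n (X : 'M[C]_n) c : opnorm_sq_le X c -> opnorm_sq_le (- X) c.
Proof.
by move=> /(opnorm_sq_leZ (-1)); rewrite scaleN1r normrN1 expr1n mul1r.
Qed.

Lemma opnorm_sq_le_spectral n (P : 'M[C]_n) (d : 'rV[C]_n) c :
  P \is unitarymx -> (forall i, `|d 0 i| ^+ 2 <= c) ->
  opnorm_sq_le (P ^t* *m diag_mx d *m P) c.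
Proof.
move=> uP dc v; rewrite !mulmxA sqn_unitary //.
rewrite -[leRHS](congr1 (fun x => c * x) (@sqn_unitary _ v (P ^t*) _));
  last by rewrite trmxC_unitary.
rewrite mulr_sumr; apply: ler_sum => i _.
by rewrite mul_mx_diag mxE normrM exprMn mulrC ler_wpM2r ?exprn_ge0.
Qed.

(** Schur's test: bounds on the absolute row and column sums bound the norm. *)
Lemma opnorm_sq_le_schur n (X : 'M[C]_n) c : 0 <= c ->
  (forall j, \sum_k `|X j k| <= c) -> (forall k, \sum_j `|X j k| <= c) ->
  opnorm_sq_le X (c ^+ 2).
Proof.
move=> c0 rX cX v.
have col k : `|(v *m X) 0 k| ^+ 2 <= c * \sum_j `|v 0 j| ^+ 2 * `|X j k|.
  apply: (@le_trans _ _ ((\sum_j `|v 0 j| * `|X j k|) ^+ 2)).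
    rewrite lerXn2r ?nnegrE ?sumr_ge0 //.
    rewrite mxE; apply: le_trans (ler_norm_sum _ _ _) _.
    by apply: ler_sum => j _; rewrite normrM.
  apply: (@le_trans _ _ ((\sum_i `|X i k|) * \sum_j `|v 0 j| ^+ 2 * `|X j k|));
    last first.
    by apply: ler_wpM2r => //; apply: sumr_ge0 => j _; rewrite mulr_ge0 ?exprn_ge0.
(* After doubling, the square of the sum is compared term by term through
     2 |v_i| |v_j| <= |v_i|^2 + |v_j|^2. *)
  have h2 : 0 < 2 :> C by rewrite ltr0n.
  rewrite -(ler_pM2l h2) [leRHS]mulr_natl mulr2n expr2 big_distrlr /=.
  rewrite [X in _ <= X + _]mulrC !big_distrlr /= -big_split mulr_sumr.
  apply: ler_sum => i _; rewrite -big_split mulr_sumr; apply: ler_sum => j _ /=.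
  rewrite -subr_ge0.
  rewrite (_ : _ - _ = `|X i k| * `|X j k| * (`|v 0 i| - `|v 0 j|) ^+ 2);
    last by ring.
  by rewrite mulr_ge0 ?(mulr_ge0 (normr_ge0 _)) // real_exprn_even_ge0 //
    realB ?normr_real.
apply: le_trans (ler_sum _ (fun k _ => col k)) _.
rewrite -mulr_sumr expr2 -mulrA ler_wpM2l // exchange_big mulr_sumr.
apply: ler_sum => j _; rewrite -mulr_sumr mulrC ler_wpM2r ?exprn_ge0 //.
Qed.

Lemma opnorm_sq_le_ex n (X : 'M[C]_n) : exists2 c, 0 <= c & opnorm_sq_le X c.
Proof.
pose c := \sum_j \sum_k `|X j k|.
have c0 : 0 <= c by apply: sumr_ge0 => j _; apply: sumr_ge0.
exists (c ^+ 2); first by rewrite exprn_ge0.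
apply: opnorm_sq_le_schur => // [j|k].
  by rewrite [leRHS](bigD1 j) //= lerDl; apply: sumr_ge0 => i _; apply: sumr_ge0.
rewrite /c exchange_big [leRHS](bigD1 k) //= lerDl.
by apply: sumr_ge0 => i _; apply: sumr_ge0.
Qed.

End Operators.

(** * Matrices in unitary diagonal form *)

Section SpectralForm.
Context {C : numClosedFieldType}.

Lemma hermitian_spectral n (A : 'M[C]_n) : A ^t* = A ->
  exists (P : 'M[C]_n) (d : 'rV[C]_n),
    [/\ P \is unitarymx, A = P ^t* *m diag_mx d *m P &
        forall i, d 0 i \is Num.real].
Proof.
move=> hA; have hermA : A \is hermsymmx.
  by apply/is_hermitianmxP; rewrite expr0 scale1r hA.
exists (spectralmx A), (spectral_diag A); split.
- exact: spectral_unitarymx.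
- rewrite -invmx_unitary ?spectral_unitarymx //.
  exact/orthomx_spectralP/hermitian_normalmx.
- by move=> i; apply: (mxOverP (hermitian_spectral_diag_real hermA)).
Qed.

Lemma char_poly_similar n (P A B : 'M[C]_n) :
  P \in unitmx -> A *m P = P *m B -> char_poly A = char_poly B.
Proof.
move=> uP AP.
have uP' : \det (map_mx polyC P) != 0.
  by rewrite det_map_mx polyC_eq0 -unitfE -unitmxE.
apply: (mulIf uP'); rewrite -det_mulmx mulrC -det_mulmx.
congr (\det _); rewrite /char_poly_mx mulmxBl mulmxBr -!map_mxM AP.
by congr (_ - _); rewrite scalar_mxC.
Qed.

Lemma char_poly_diag n (d : 'rV[C]_n) :
  char_poly (diag_mx d) = \prod_i ('X - (d 0 i)%:P).
Proof.
rewrite char_poly_trig ?diag_mx_is_trig //.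
by apply: eq_bigr => i _; rewrite mxE eqxx.
Qed.

Lemma char_poly_spectral n (P : 'M[C]_n) (d : 'rV[C]_n) :
  P \is unitarymx ->
  char_poly (P ^t* *m diag_mx d *m P) = \prod_i ('X - (d 0 i)%:P).
Proof.
move=> uP; rewrite -char_poly_diag; apply: (@char_poly_similar _ (P ^t*)).
  by rewrite unitarymx_unit ?trmxC_unitary.
by rewrite mulmxtVK.
Qed.

Lemma mul_spectral n (P : 'M[C]_n) (d e : 'rV[C]_n) : P \is unitarymx ->
  (P ^t* *m diag_mx d *m P) *m (P ^t* *m diag_mx e *m P) =
  P ^t* *m diag_mx (\row_i (d 0 i * e 0 i)) *m P.
Proof.
move=> uP; rewrite !mulmxA mulmxtVK // -[_ *m diag_mx d *m _]mulmxA.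
by rewrite mulmx_diag.
Qed.

Lemma one_spectral n (P : 'M[C]_n) : P \is unitarymx ->
  P ^t* *m diag_mx (const_mx 1) *m P = 1%:M.
Proof.
move=> uP; rewrite diag_const_mx mulmx1 -{2}(trmxCK P).
by apply/unitarymxP; rewrite trmxC_unitary.
Qed.

Lemma exp_spectral n (P : 'M[C]_n) (d : 'rV[C]_n) k :
  P \is unitarymx ->
  (P ^t* *m diag_mx d *m P) ^+ k = P ^t* *m diag_mx (\row_i d 0 i ^+ k) *m P.
Proof.
move=> uP; elim: k => [|k IH].
  rewrite expr0 -[LHS](one_spectral uP); congr (_ *m diag_mx _ *m _).
  by apply/rowP => i; rewrite !mxE expr0.
rewrite exprS IH [LHS]mul_spectral //; congr (_ *m diag_mx _ *m _).
by apply/rowP => i; rewrite !mxE exprS.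
Qed.

Lemma unitary_mul_row_adj n (P : 'M[C]_n) i : P \is unitarymx ->
  P *m (row i P) ^t* = (row i (1%:M : 'M[C]_n)) ^t*.
Proof.
move=> uP; rewrite -(unitarymxP uP) row_mul.
by rewrite trmx_mul map_mxM -map_trmx trmxCK.
Qed.

(** The rows of P are the left eigenvectors of P^* D P. *)
Lemma spectral_rayleigh n (P : 'M[C]_n) (d : 'rV_n) i : P \is unitarymx ->
  (row i P *m (P ^t* *m diag_mx d *m P) *m (row i P) ^t*) 0 0 = d 0 i.
Proof.
move=> uP; rewrite !mulmxA -row_mul (unitarymxP uP) -!mulmxA.
rewrite unitary_mul_row_adj // mulmxA mxE (bigD1 i) //= big1.
  by rewrite mul_mx_diag !mxE eqxx mulr1n mul1r conjC1 mulr1 addr0.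
by move=> j ji; rewrite mul_mx_diag !mxE eq_sym (negbTE ji) mul0r mul0r.
Qed.

Lemma sqn_row_unitary n (P : 'M[C]_n) i : P \is unitarymx -> sqn (row i P) = 1.
Proof.
move=> uP; have <- : (P *m P ^t*) i i = 1 by rewrite (unitarymxP uP) mxE eqxx.
by rewrite mxE; apply: eq_bigr => j _; rewrite !mxE normCK.
Qed.

Lemma spectral_hermitian n (P : 'M[C]_n) (d : 'rV_n) :
  (forall i, d 0 i \is Num.real) ->
  (P ^t* *m diag_mx d *m P) ^t* = P ^t* *m diag_mx d *m P.
Proof.
move=> dr; rewrite !trmx_mul !map_mxM trmxCK mulmxA; congr (_ *m _ *m _).
rewrite tr_diag_mx map_diag_mx; congr diag_mx; apply/rowP => i.
by rewrite mxE; apply/CrealP.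
Qed.

Lemma spectral_diag_inj n (P : 'M[C]_n) (d e : 'rV_n) : P \is unitarymx ->
  P ^t* *m diag_mx d *m P = P ^t* *m diag_mx e *m P -> d = e.
Proof.
move=> uP de; apply/rowP => i.
by rewrite -(spectral_rayleigh d i uP) de spectral_rayleigh.
Qed.

Lemma hermitian_spectral_real n (P : 'M[C]_n) (d : 'rV_n) : P \is unitarymx ->
  (P ^t* *m diag_mx d *m P) ^t* = P ^t* *m diag_mx d *m P ->
  forall i, d 0 i \is Num.real.
Proof.
move=> uP hd i; apply/CrealP.
have : P ^t* *m diag_mx (map_mx Num.conj d) *m P = P ^t* *m diag_mx d *m P.
  rewrite -[RHS]hd !trmx_mul !map_mxM trmxCK mulmxA.
  by rewrite tr_diag_mx map_diag_mx.
by move/(spectral_diag_inj uP)/rowP/(_ i); rewrite mxE.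
Qed.

Lemma spectral_inv n (P : 'M[C]_n) (d : 'rV_n) : P \is unitarymx ->
  (forall i, d 0 i != 0) ->
  let X := P ^t* *m diag_mx d *m P in
  X \in unitmx /\ invmx X = P ^t* *m diag_mx (\row_i (d 0 i)^-1) *m P.
Proof.
move=> uP d0 X; set Y := _ *m P.
have XY : X *m Y = 1%:M.
  rewrite mul_spectral // -(one_spectral uP); congr (_ *m diag_mx _ *m _).
  by apply/rowP => i; rewrite !mxE mulfV.
have [uX _] := mulmx1_unit XY; split=> //.
by rewrite -[LHS]mulmx1 -XY mulKmx.
Qed.

Lemma eq_spectral n (P : 'M[C]_n) (d e : 'rV_n) : d = e ->
  P ^t* *m diag_mx d *m P = P ^t* *m diag_mx e *m P.
Proof. by move=> ->. Qed.

Lemma unit_spectral_neq0 n (P : 'M[C]_n) (d : 'rV_n) : P \is unitarymx ->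
  P ^t* *m diag_mx d *m P \in unitmx -> forall i, d 0 i != 0.
Proof.
move=> uP; rewrite !unitmx_mul => /andP[/andP[_ ud] _] i.
move: ud; rewrite unitmxE det_diag unitfE => /prodf_neq0; exact.
Qed.

(** The rows of P indexed by I span a space on which P^* D P = E + L multiplies
    squared norms by more than c, whereas E multiplies them by at most c.  If
    #|I| exceeded the rank of L, some nonzero vector w P of this space would
    be killed by L. *)
Lemma card_large_le_rank n (P E L : 'M[C]_n) (d : 'rV[C]_n) (c : C)
    (I : {set 'I_n}) :
  P \is unitarymx -> P ^t* *m diag_mx d *m P = E + L -> opnorm_sq_le E c ->
  (forall i, i \in I -> c < `|d 0 i| ^+ 2) -> (#|I| <= \rank L)%N.
Proof.
move=> uP dEL Ec dI; rewrite leqNgt; apply/negP => ltI.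
pose B : 'M[C]_(#|I|, n) := \matrix_(i, j) (enum_val i == j)%:R.
have /rowV0Pn [u /sub_kermxP uK u0] : kermx (B *m P *m L) != 0.
  rewrite -mxrank_eq0 mxrank_ker subn_eq0 -ltnNge.
  exact: leq_ltn_trans (mxrankM_maxr _ _) ltI.
pose w := u *m B.
have wE i : w 0 (enum_val i) = u 0 i.
  rewrite mxE (bigD1 i) //= mxE eqxx mulr1 big1 ?addr0 // => j ji.
  by rewrite mxE (inj_eq enum_val_inj) (negbTE ji) mulr0.
have w0 j : j \notin I -> w 0 j = 0.
  move=> jI; rewrite mxE big1 // => i _; rewrite mxE.
  by case: eqP => [e|]; rewrite ?mulr0 //; case/negP: jI; rewrite -e enum_valP.
have wn0 : w != 0.
  apply: contraNneq u0 => e; apply/eqP/rowP => i.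
  by rewrite -wE e !mxE.
have : sqn (w *m diag_mx d) <= c * sqn w.
  rewrite -(sqn_unitary w uP).
  have -> : sqn (w *m diag_mx d) = sqn (w *m P *m E).
    have -> : w *m P *m E = w *m P *m (E + L).
      have wL : w *m P *m L = 0 by rewrite /w -uK !mulmxA.
      by rewrite mulmxDr wL addr0.
    by rewrite -dEL !mulmxA (mulmxtVK w) // (sqn_unitary _ uP).
  exact: Ec.
move=> /le_lt_trans-/(_ (sqn (w *m diag_mx d))); rewrite ltxx => absurd.
suff: c * sqn w < sqn (w *m diag_mx d) by move/absurd.
have [i wi] : exists i, w 0 i != 0 by exact/rV0Pn.
have dw j : `|(w *m diag_mx d) 0 j| ^+ 2 = `|d 0 j| ^+ 2 * `|w 0 j| ^+ 2.
  by rewrite mul_mx_diag mxE normrM exprMn mulrC.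
rewrite /sqn mulr_sumr (bigD1 i) //= [ltRHS](bigD1 i) //=.
apply: ltr_leD.
  rewrite dw ltr_pM2r ?exprn_gt0 ?normr_gt0 // dI //.
  by apply: contraNT wi => /w0 ->.
apply: ler_sum => j _; rewrite dw.
have [jI|/w0 ->] := boolP (j \in I).
  by rewrite ler_wpM2r ?exprn_ge0 // ltW ?dI.
by rewrite normr0 expr0n !mulr0.
Qed.

End SpectralForm.

(** * Essentially small families of matrices *)

Section Trim.
Context {F : fieldType}.

Definition trim {n} N0 (D : 'M[F]_n) : 'M[F]_n :=
  \matrix_(j, k) (if (N0 <= j)%N && (N0 <= k)%N then D j k else 0).

Lemma rank_sub_trim n N0 (D : 'M[F]_n) : (N0 <= n)%N ->
  (\rank (D - trim N0 D)%R <= N0 + N0)%N.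
Proof.
move=> N0n; pose P : 'M[F]_n := pid_mx N0.
have rP : (\rank P <= N0)%N by rewrite rank_pid_mx.
have PE (X : 'M[F]_n) j k : (P *m X) j k = (j < N0)%N%:R * X j k.
  rewrite mxE (bigD1 j) //= big1 ?addr0; first by rewrite mxE eqxx.
  by move=> i ij; rewrite mxE eq_sym val_eqE (negbTE ij) mul0r.
have EP (X : 'M[F]_n) j k : (X *m P) j k = X j k * (k < N0)%N%:R.
  rewrite mxE (bigD1 k) //= big1 ?addr0; first by rewrite mxE eqxx.
  by move=> i ik; rewrite mxE val_eqE (negbTE ik) mulr0.
have -> : D - trim N0 D = P *m D + (D - P *m D) *m P.
  apply/matrixP => j k.
  have addE (X Y : 'M[F]_n) : (X + Y) j k = X j k + Y j k by rewrite mxE.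
  have subE (X Y : 'M[F]_n) : (X - Y) j k = X j k - Y j k by rewrite !mxE.
  rewrite [in RHS]addE EP !subE PE [trim _ _ _ _]mxE !ltnNge.
  by case: (N0 <= j)%N; case: (N0 <= k)%N; rewrite /= ?mulr0n ?mulr1n; ring.
apply: leq_trans (mxrank_add _ _) _; apply: leq_add.
  exact: leq_trans (mxrankM_maxl _ _) rP.
exact: leq_trans (mxrankM_maxr _ _) rP.
Qed.

End Trim.

Section EssentiallySmall.
Context {C : numClosedFieldType}.
Implicit Types X Y : forall n, 'M[C]_n.

(** These are the matrix sequences clustered at zero: small norm up to a
    correction of bounded rank. *)
Definition essentially_small X := forall eps : C, 0 < eps ->
  exists M N : nat, forall n, (N < n)%N ->
  exists E L : 'M[C]_n, [/\ X n = E + L, opnorm_sq_le E eps & (\rank L <= M)%N].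

Definition opnorm_bounded X := exists (c : C) (N : nat), 0 <= c /\
  forall n, (N < n)%N -> opnorm_sq_le (X n) c.

Lemma esmall_eq X Y (N0 : nat) :
  (forall n, (N0 < n)%N -> X n = Y n) -> essentially_small X -> essentially_small Y.
Proof.
move=> XY nX eps e0; have [M [N XN]] := nX _ e0.
exists M, (maxn N0 N) => n; rewrite gtn_max => /andP[n0 nN].
by rewrite -XY //; exact: XN.
Qed.

Lemma esmall_approx X :
  (forall eps : C, 0 < eps -> exists Y, essentially_small Y /\
     exists N : nat, forall n, (N < n)%N -> opnorm_sq_le (X n - Y n) eps) ->
  essentially_small X.
Proof.
move=> aX eps e0; have e4 : 0 < eps / 4 by rewrite divr_gt0 ?ltr0n.
have [Y [nY [N1 XY]]] := aX _ e4; have [M [N2 YN]] := nY _ e4.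
exists M, (maxn N1 N2) => n; rewrite gtn_max => /andP[n1 n2].
have [E [L [YE Ee rL]]] := YN n n2.
exists ((X n - Y n) + E), L; split=> //; first by rewrite -addrA -YE subrK.
apply: opnorm_sq_leW (opnorm_sq_leD (XY n n1) Ee).
by rewrite le_eqVlt; apply/orP; left; apply/eqP; field.
Qed.

Lemma esmallD X Y :
  essentially_small X -> essentially_small Y -> essentially_small (fun n => X n + Y n).
Proof.
move=> nX nY eps e0; have e4 : 0 < eps / 4 by rewrite divr_gt0 ?ltr0n.
have [M1 [N1 XN]] := nX _ e4; have [M2 [N2 YN]] := nY _ e4.
exists (M1 + M2)%N, (maxn N1 N2) => n; rewrite gtn_max => /andP[n1 n2].
have [E1 [L1 [XE Ee1 rL1]]] := XN n n1.
have [E2 [L2 [YE Ee2 rL2]]] := YN n n2.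
exists (E1 + E2), (L1 + L2); split; first by rewrite XE YE addrACA.
  apply: opnorm_sq_leW (opnorm_sq_leD Ee1 Ee2).
  by rewrite le_eqVlt; apply/orP; left; apply/eqP; field.
by apply: leq_trans (mxrank_add _ _) _; rewrite leq_add.
Qed.

Lemma esmallMl X Y :
  opnorm_bounded Y -> essentially_small X -> essentially_small (fun n => Y n *m X n).
Proof.
move=> [c [N1 [c0 bY]]] nX eps e0.
have e1 : 0 < eps / (c + 1) by rewrite divr_gt0 ?ltr_wpDl.
have [M [N2 XN]] := nX _ e1.
exists M, (maxn N1 N2) => n; rewrite gtn_max => /andP[n1 n2].
have [E [L [XE Ee rL]]] := XN n n2.
exists (Y n *m E), (Y n *m L); split; first by rewrite XE mulmxDr.
  apply: opnorm_sq_leW (opnorm_sq_leM (ltW e1) (bY n n1) Ee).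
  by rewrite mulrA ler_pdivrMr ?ltr_wpDl // mulrC ler_wpM2l ?(ltW e0) // lerDl.
exact: leq_trans (mxrankM_maxr _ _) rL.
Qed.

Lemma esmallMr X Y :
  opnorm_bounded Y -> essentially_small X -> essentially_small (fun n => X n *m Y n).
Proof.
move=> [c [N1 [c0 bY]]] nX eps e0.
have e1 : 0 < eps / (c + 1) by rewrite divr_gt0 ?ltr_wpDl.
have [M [N2 XN]] := nX _ e1.
exists M, (maxn N1 N2) => n; rewrite gtn_max => /andP[n1 n2].
have [E [L [XE Ee rL]]] := XN n n2.
exists (E *m Y n), (L *m Y n); split; first by rewrite XE mulmxDl.
  apply: opnorm_sq_leW (opnorm_sq_leM c0 Ee (bY n n1)).
  by rewrite mulrAC ler_pdivrMr ?ltr_wpDl // ler_wpM2l ?(ltW e0) // lerDl.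
exact: leq_trans (mxrankM_maxl _ _) rL.
Qed.

Lemma boundedM X Y :
  opnorm_bounded X -> opnorm_bounded Y -> opnorm_bounded (fun n => X n *m Y n).
Proof.
move=> [c [N1 [c0 bX]]] [d [N2 [d0 bY]]]; exists (c * d), (maxn N1 N2).
split=> [|n]; first exact: mulr_ge0.
by rewrite gtn_max => /andP[n1 n2]; apply: opnorm_sq_leM; [| exact: bX | exact: bY].
Qed.

Lemma bounded_scalar (a : C) : opnorm_bounded (fun n => a%:M).
Proof.
exists (`|a| ^+ 2), 0%N; split=> [|n _ v]; first by rewrite exprn_ge0.
by rewrite mul_mx_scalar sqnZ.
Qed.

Lemma boundedX X k : opnorm_bounded X -> opnorm_bounded (fun n => X n ^+ k).
Proof.
move=> bX; elim: k => [|k IH]; first exact: (bounded_scalar 1).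
have [c [N [c0 b]]] := boundedM bX IH; exists c, N; split=> // n nN.
by rewrite exprS; exact: b.
Qed.

Lemma esmall0 : essentially_small (fun n => 0).
Proof.
move=> eps e0; exists 0%N, 0%N => n _; exists 0, 0; split.
- by rewrite addr0.
- move=> v; rewrite mulmx0 -[0](scale0r 0) sqnZ normr0 expr0n mul0r.
  by rewrite mulr_ge0 ?sqn_ge0 ?ltW.
- by rewrite mxrank0.
Qed.

(** Telescoping: X^(k+1) - Y^(k+1) = X (X^k - Y^k) + (X - Y) Y^k. *)
Lemma esmall_subX X Y k : opnorm_bounded X -> opnorm_bounded Y ->
  essentially_small (fun n => X n - Y n) ->
  essentially_small (fun n => X n ^+ k - Y n ^+ k).
Proof.
move=> bX bY nXY; elim: k => [|k IH].
  by apply: (@esmall_eq _ _ 0%N _ esmall0) => n _; rewrite !expr0 subrr.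
have := esmallD (esmallMl bX IH) (esmallMr (boundedX k bY) nXY).
apply: (@esmall_eq _ _ 0%N) => n _.
by rewrite !exprS mulmxBr mulmxBl addrA subrK.
Qed.

Lemma esmall_sub_poly X Y (a : nat -> C) K : opnorm_bounded X -> opnorm_bounded Y ->
  essentially_small (fun n => X n - Y n) ->
  essentially_small (fun n =>
    \sum_(k < K) a k *: X n ^+ k - \sum_(k < K) a k *: Y n ^+ k).
Proof.
move=> bX bY nXY; elim: K => [|K IH].
  by apply: (@esmall_eq _ _ 0%N _ esmall0) => n _; rewrite !big_ord0 subrr.
have := esmallD IH
  (esmallMl (bounded_scalar (a K)) (esmall_subX K bX bY nXY)).
apply: (@esmall_eq _ _ 0%N) => n _.
by rewrite !big_ord_recr /= mul_scalar_mx scalerBr opprD addrACA.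
Qed.

(** An eigenvalue d at distance more than eps from 1 and from -1 has
    |d^2 - 1| = |d - 1| |d + 1| > eps^2, so it counts as a large eigenvalue of
    H^2 - 1; eps^4 is the corresponding bound for squared norms. *)
Theorem outliers_of_essentially_small (H : forall n, 'M[C]_n) :
  essentially_small (fun n => H n *m H n - 1%:M) ->
  forall eps : C, 0 < eps -> exists M N : nat, forall n, (N < n)%N ->
  forall (P : 'M[C]_n) (d : 'rV[C]_n), P \is unitarymx ->
  H n = P ^t* *m diag_mx d *m P ->
  (#|[pred i | ((eps < `|d 0 i - 1|) && (eps < `|d 0 i + 1|))%R]| <= M)%N.
Proof.
move=> nH eps e0.
have e4 : 0 < eps ^+ 4 by rewrite exprn_gt0.
have [M [N HN]] := nH _ e4; exists M, N => n nN P d uP HE.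
have [E [L [EL Ee rL]]] := HN n nN; apply: leq_trans rL.
rewrite -cardsE.
apply: (@card_large_le_rank _ _ P E L
  (\row_i (d 0 i * d 0 i) - const_mx 1) _ _ uP _ Ee).
  rewrite -EL HE mul_spectral // -(one_spectral uP) -mulmxBl -mulmxBr.
  by rewrite -linearB.
move=> i; rewrite inE => /andP[d1 d2]; rewrite !mxE.
rewrite (_ : _ - 1 = (d 0 i - 1) * (d 0 i + 1)); last by ring.
rewrite (_ : eps ^+ 4 = (eps * eps) ^+ 2); last by ring.
rewrite ltrXn2r ?nnegrE ?mulr_ge0 ?normr_ge0 ?ltW // normrM.
by rewrite ltr_pM ?ltW.
Qed.

End EssentiallySmall.

(** * Power series evaluated at matrices *)

Section ComplexLimits.
Context {R : realType}.
Implicit Types z w : R[i].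

Lemma normCE z : `|z| = (normc z)%:C.
Proof. by rewrite normc_def; case: z. Qed.

Lemma normc_ge0 z : 0 <= normc z.
Proof. by rewrite -ler0c -normCE. Qed.

Lemma conjCE z : Num.conj z = conjc z.
Proof. by []. Qed.

Lemma normc_le_ReIm z : normc z <= `|complex.Re z| + `|complex.Im z|.
Proof.
case: z => x y /=.
rewrite -(ler_sqr) ?nnegrE ?addr_ge0 ?sqrtr_ge0 // sqr_sqrtr ?addr_ge0 ?sqr_ge0 //.
rewrite sqrrD !(real_normK (num_real _)).
have : 0 <= `|x| * `|y| by rewrite mulr_ge0.
by move: (`|x| * `|y|) => t t0; rewrite mulr2n; lra.
Qed.

Lemma Re_le_normc z : `|complex.Re z| <= normc z.
Proof.
case: z => x y /=; rewrite -sqrtr_sqr ler_sqrt ?addr_ge0 ?sqr_ge0 //.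
by rewrite lerDl sqr_ge0.
Qed.

Lemma Im_le_normc z : `|complex.Im z| <= normc z.
Proof.
case: z => x y /=; rewrite -sqrtr_sqr ler_sqrt ?addr_ge0 ?sqr_ge0 //.
by rewrite lerDr sqr_ge0.
Qed.

Lemma cReD z w : complex.Re (z + w) = complex.Re z + complex.Re w.
Proof. by case: z w => [? ?] [? ?]. Qed.
Lemma cImD z w : complex.Im (z + w) = complex.Im z + complex.Im w.
Proof. by case: z w => [? ?] [? ?]. Qed.
Lemma cReM z w : complex.Re (z * w) =
  complex.Re z * complex.Re w - complex.Im z * complex.Im w.
Proof. by case: z w => [? ?] [? ?]. Qed.
Lemma cImM z w : complex.Im (z * w) =
  complex.Re z * complex.Im w + complex.Im z * complex.Re w.
Proof. by case: z w => [? ?] [? ?]. Qed.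
Lemma cReN z : complex.Re (- z) = - complex.Re z.
Proof. by case: z. Qed.
Lemma cImN z : complex.Im (- z) = - complex.Im z.
Proof. by case: z. Qed.

Lemma ccvgD (u v : nat -> R[i]) k l :
  ccvg_to u k -> ccvg_to v l -> ccvg_to (fun n => u n + v n) (k + l).
Proof.
move=> [u1 u2] [v1 v2]; split; rewrite ?cReD ?cImD.
  by under eq_fun do rewrite cReD; exact: cvgD.
by under eq_fun do rewrite cImD; exact: cvgD.
Qed.

Lemma ccvgMl (u : nat -> R[i]) l c :
  ccvg_to u l -> ccvg_to (fun n => c * u n) (c * l).
Proof.
move=> [u1 u2]; split; rewrite ?cReM ?cImM.
  by under eq_fun do rewrite cReM; apply: cvgB; apply: cvgMl_tmp.
by under eq_fun do rewrite cImM; apply: cvgD; apply: cvgMl_tmp.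
Qed.

Lemma ccvg_sum (I : Type) (s : seq I) (u : I -> nat -> R[i]) l :
  (forall i, ccvg_to (u i) (l i)) ->
  ccvg_to (fun n => \sum_(i <- s) u i n) (\sum_(i <- s) l i).
Proof.
move=> ul; elim: s => [|i s IH].
  rewrite big_nil; under [X in ccvg_to X]eq_fun do rewrite big_nil.
  by split; exact: cvg_cst.
rewrite big_cons; under [X in ccvg_to X]eq_fun do rewrite big_cons.
exact: ccvgD.
Qed.

Lemma ccvg_lim (u : nat -> R[i]) l : ccvg_to u l -> clim u = l.
Proof.
by move=> [u1 u2]; rewrite /clim (cvg_lim _ u1) // (cvg_lim _ u2) //; case: l {u1 u2}.
Qed.

(** The factor 2 comes from passing to the limit separately in real and imaginary
    parts. *)
Lemma ccvg_normc_le (u : nat -> R[i]) l w c (N : nat) : ccvg_to u l ->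
  (forall n, (N <= n)%N -> normc (u n - w) <= c) -> normc (l - w) <= 2 * c.
Proof.
move=> [u1 u2] uc.
have h (g : R[i] -> R) (gB : forall x y, g (x - y) = g x - g y)
    (gn : forall x, `|g x| <= normc x) :
    (fun n => g (u n)) @ \oo --> g l -> `|g (l - w)| <= c.
  move=> ug; have cv : (fun n => `|g (u n) - g w|) @ \oo --> `|g l - g w|.
    by apply: cvg_norm; apply: cvgB => //; exact: cvg_cst.
  rewrite gB -(cvg_lim _ cv) //; apply: limr_le.
    by apply/cvg_ex; exists `|g l - g w|.
  near=> n; rewrite -gB; apply: le_trans (gn _) _; apply: uc.
  by near: n; exact: nbhs_infty_ge.
apply: le_trans (normc_le_ReIm _) _; rewrite mulr_natl mulr2n lerD //.
  by apply: h => // [x y|]; [rewrite cReD cReN | exact: Re_le_normc].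
by apply: h => // [x y|]; [rewrite cImD cImN | exact: Im_le_normc].
Unshelve. all: by end_near.
Qed.

(** Convergence at rho' > rho bounds the terms a_k rho'^k, so the series is
    dominated on the disc of radius rho by a geometric series of ratio
    q = rho / rho'.  With K = 0 this also bounds h there. *)
Lemma power_series_tail (h : R[i] -> R[i]) a r (rho rho' : R) :
  power_series_on h a r -> 0 <= rho -> rho < rho' -> (rho'%:E < r)%E ->
  exists B q : R, [/\ 0 <= B, 0 <= q, q < 1 &
    forall z K, normc z <= rho -> normc (h z - psum a z K) <= B * q ^+ K].
Proof.
move=> hs rho0 lt_rho ltr.
have rho'0 : 0 < rho' by apply: le_lt_trans lt_rho.
have nrho' : normc rho'%:C = rho'.
  by apply: complexI; rewrite -normCE ger0_norm // ler0c ltW.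
have [|h1 h2] := hs rho'%:C; first by rewrite nrho'.
have [B B0 aB] : exists2 B : R, 0 <= B & forall k, normc (a k) * rho' ^+ k <= B.
  have [B1 B1P] : exists B1 : R, forall n, `|complex.Re (psum a rho'%:C n)| <= B1.
    have /cvg_seq_bounded [M [_ MP]] :
        cvgn (fun n => complex.Re (psum a rho'%:C n)).
      by apply/cvg_ex; eexists; exact: h1.
    by exists (M + 1) => n; apply: MP => //; rewrite ltrDl.
  have [B2 B2P] : exists B2 : R, forall n, `|complex.Im (psum a rho'%:C n)| <= B2.
    have /cvg_seq_bounded [M [_ MP]] :
        cvgn (fun n => complex.Im (psum a rho'%:C n)).
      by apply/cvg_ex; eexists; exact: h2.
    by exists (M + 1) => n; apply: MP => //; rewrite ltrDl.
  have psB n : normc (psum a rho'%:C n) <= B1 + B2.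
    by apply: le_trans (normc_le_ReIm _) _; rewrite lerD.
  exists ((B1 + B2) + (B1 + B2)) => [|k].
    by rewrite addr_ge0 // (le_trans (normc_ge0 _) (psB 0%N)).
  have -> : normc (a k) * rho' ^+ k =
      normc (psum a rho'%:C k.+1 - psum a rho'%:C k).
    rewrite /psum big_ord_recr /= [X in X - _]addrC addrK normcM; congr (_ * _).
    by elim: k => [|k IH]; rewrite ?expr0 ?normc1 // !exprS normcM -IH nrho'.
  by apply: le_trans (le_normcD _ _) _; rewrite normcN lerD.
pose q := rho / rho'.
have q0 : 0 <= q by rewrite divr_ge0 // ltW.
have q1 : q < 1 by rewrite ltr_pdivrMr // mul1r.
exists (2 * (B / (1 - q))), q; split => //.
  by rewrite mulr_ge0 // divr_ge0 // subr_ge0 ltW.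
move=> z K zrho.
have term k : normc (a k * z ^+ k) <= B * q ^+ k.
  rewrite normcM; have -> : normc (z ^+ k) = normc z ^+ k.
    by elim: k => [|k IH]; rewrite ?expr0 ?normc1 // !exprS normcM -IH.
  apply: (@le_trans _ _ (normc (a k) * rho ^+ k)).
    by rewrite ler_wpM2l ?normc_ge0 // lerXn2r // ?nnegrE ?normc_ge0.
  rewrite /q expr_div_n mulrA ler_pdivlMr ?exprn_gt0 // mulrAC.
  by rewrite ler_wpM2r // exprn_ge0.
have part j : normc (psum a z (K + j) - psum a z K) <=
    B * q ^+ K * ((1 - q ^+ j) / (1 - q)).
  elim: j => [|j IH]; first by rewrite addn0 subrr normc0 expr0 subrr mul0r mulr0.
  rewrite addnS /psum big_ord_recr /= -/(psum _ _ _) addrAC.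
  apply: le_trans (le_normcD _ _) _; apply: le_trans (lerD IH (term _)) _.
  rewrite le_eqVlt; apply/orP; left; apply/eqP; rewrite exprD exprS; field.
  by rewrite subr_eq0 eq_sym lt_eqF.
rewrite -mulrA; apply: (@ccvg_normc_le (psum a z) _ _ _ K); first apply: hs.
  by apply: lt_trans ltr; rewrite lte_fin; exact: le_lt_trans lt_rho.
move=> n /subnKC <-; apply: le_trans (part _) _.
rewrite [leLHS](_ : _ = B / (1 - q) * q ^+ K * (1 - q ^+ (n - K))); last by ring.
rewrite ler_piMr ?mulr_ge0 ?exprn_ge0 ?invr_ge0 ?subr_ge0 ?(ltW q1) //.
by rewrite gerBl exprn_ge0.
Qed.

Lemma power_series_real (h : R[i] -> R[i]) a r z :
  power_series_on h a r -> (forall k, a k \is Num.real) -> z \is Num.real ->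
  ((normc z)%:E < r)%E -> h z \is Num.real.
Proof.
move=> hs ar zr /hs [_ h2].
have : complex.Im (h z) = 0.
  rewrite -(cvg_lim _ h2) // (_ : (fun _ => _) = fun=> 0) ?lim_cst //.
  apply/funext => n; have : psum a z n \is Num.real.
    by apply: rpred_sum => k _; rewrite realM ?realX.
  by move/RIm_real/complexI.
by case: (h z) => x y /= ->; rewrite complex_real.
Qed.

Lemma psum_spectral n (P : 'M[R[i]]_n) (d : 'rV_n) (a : nat -> R[i]) K :
  P \is unitarymx ->
  \sum_(k < K) a k *: (P ^t* *m diag_mx d *m P) ^+ k =
  P ^t* *m diag_mx (\row_i psum a (d 0 i) K) *m P.
Proof.
move=> uP; under eq_bigr do rewrite exp_spectral // scalemxAl scalemxAr.
rewrite -mulmx_suml -mulmx_sumr; congr (_ *m _ *m _).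
apply/matrixP => i j; rewrite summxE !mxE /psum -sumrMnl; apply: eq_bigr => k _.
by rewrite !mxE mulrnAr.
Qed.

(** Functional calculus: the entries of the partial sums are fixed linear
    combinations of the scalar partial sums at the d_i. *)
Lemma matfun_spectral h a r n (P : 'M[R[i]]_n) (d : 'rV_n) :
  power_series_on h a r -> P \is unitarymx ->
  (forall i, ((normc (d 0 i))%:E < r)%E) ->
  matfun a (P ^t* *m diag_mx d *m P) = P ^t* *m diag_mx (\row_i h (d 0 i)) *m P.
Proof.
move=> hs uP dr; apply/matrixP => i j; rewrite mxE; apply: ccvg_lim.
have entry (e : 'rV[R[i]]_n) :
    (P ^t* *m diag_mx e *m P) i j = \sum_l (P l j * (P ^t*) i l) * e 0 l.
  rewrite mxE; apply: eq_bigr => l _; rewrite mul_mx_diag [X in X * _]mxE.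
  by rewrite -mulrA mulrC [e 0 l * _]mulrC -!mulrA [e 0 l * _]mulrC.
under [X in ccvg_to X]eq_fun do rewrite psum_spectral // entry.
rewrite entry; apply: ccvg_sum => l; apply: ccvgMl; rewrite mxE.
by under [X in ccvg_to X]eq_fun do rewrite mxE; exact: hs.
Qed.

Lemma opnorm_sq_le_matfun_psum h a r n (P : 'M[R[i]]_n) (d : 'rV_n) K c :
  power_series_on h a r -> P \is unitarymx ->
  (forall i, ((normc (d 0 i))%:E < r)%E) ->
  (forall i, normc (h (d 0 i) - psum a (d 0 i) K) <= c) ->
  let X := P ^t* *m diag_mx d *m P in
  opnorm_sq_le (matfun a X - \sum_(k < K) a k *: X ^+ k) (c ^+ 2)%:C.
Proof.
move=> hs uP dr dc X; rewrite (matfun_spectral hs) // psum_spectral //.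
rewrite -mulmxBl -mulmxBr -linearB; apply: opnorm_sq_le_spectral => // i.
rewrite !mxE normCE -rmorphXn lecR lerXn2r ?nnegrE ?normc_ge0 //.
exact: le_trans (normc_ge0 _) (dc i).
Qed.

Lemma exists_between_EFin (x : R) (r : \bar R) : (x%:E < r)%E ->
  exists2 y : R, x < y & (y%:E < r)%E.
Proof.
case: r => [r| |] //; rewrite ?lte_fin => xr.
- by exists ((x + r) / 2); rewrite ?lte_fin; lra.
- by exists (x + 1); [rewrite ltrDl | rewrite ltry].
Qed.

Lemma eigenvalues_spectral n (P : 'M[R[i]]_n) (d : 'rV_n) :
  P \is unitarymx ->
  perm_eq (eigenvalues (P ^t* *m diag_mx d *m P)) [seq d 0 i | i <- enum 'I_n].
Proof.
move=> uP; apply: prod_XsubC_eq; rewrite /eigenvalues.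
case: closed_field_poly_normal => /= s.
rewrite (monicP (char_poly_monic _)) scale1r => <-.
by rewrite char_poly_spectral // big_map big_enum.
Qed.

Lemma spectral_radius_spectral n (P : 'M[R[i]]_n) (d : 'rV_n) rho :
  P \is unitarymx -> 0 <= rho -> (forall i, normc (d 0 i) <= rho) ->
  spectral_radius (P ^t* *m diag_mx d *m P) <= rho.
Proof.
move=> uP rho0 dr; rewrite /spectral_radius (perm_big _ (eigenvalues_spectral d uP)).
by rewrite big_map; apply: bigmax_le.
Qed.

Lemma num_outliers_spectral eps n (P : 'M[R[i]]_n) (d : 'rV_n) :
  P \is unitarymx ->
  num_outliers eps (P ^t* *m diag_mx d *m P) =
  #|[pred i | ((eps%:C < `|d 0 i - 1|) && (eps%:C < `|d 0 i + 1|))%R]|.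
Proof.
move=> uP; rewrite /num_outliers.
rewrite (permP (eigenvalues_spectral d uP)) count_map enumT cardE size_filter.
apply: eq_count => i.
rewrite -[RHS]/((eps%:C < `|d 0 i - 1|) && (eps%:C < `|d 0 i + 1|)).
by rewrite /= !normCE !ltcR.
Qed.

End ComplexLimits.

(** * Fourier coefficients and the Toeplitz quadratic form *)

Section Summable.
Context {R : realType} {T : choiceType} (g : T -> R).
Context (g_ge0 : forall t, 0 <= g t).
Context (g_summable : summable [set: T] (fun t => (g t)%:E)).

Lemma summable_seq_bound :
  exists B, forall s : seq T, uniq s -> \sum_(t <- s) g t <= B.
Proof.
move: g_summable; rewrite /summable.
have e0 : (0 <= \esum_(t in [set: T]) `|(g t)%:E|)%E by apply: esum_ge0.
move=> efin; exists (fine (\esum_(t in [set: T]) `|(g t)%:E|)%E) => s us.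
rewrite -lee_fin fineK ?ge0_fin_numE //; apply: esum_ge.
exists [set` s]; first by split => //; exact: finite_seq.
rewrite -fsbig_seq // -sumEFin; apply: lee_sum => t _.
by rewrite gee0_abs // lee_fin.
Qed.

(** A finite set s0 whose sum is within delta of the supremum leaves at most
    delta to any finite set disjoint from it. *)
Lemma summable_seq_tail (delta : R) : 0 < delta -> exists s0 : seq T,
  forall s, uniq s -> (forall t, t \in s -> t \notin s0) ->
  \sum_(t <- s) g t <= delta.
Proof.
move=> d0; pose E := [set \sum_(t <- s) g t | s in [set s : seq T | uniq s]].
have supE : has_sup E.
  split; first by exists (\sum_(t <- [::]) g t), [::].
  by have [B sB] := summable_seq_bound; exists B => _ [s us <-]; exact: sB.
have [_ [s0 us0 <-] lt0] := sup_adherent d0 supE.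
exists s0 => s us ss0.
have : \sum_(t <- s0 ++ s) g t <= sup E.
  apply: ub_le_sup; first by case: supE.
  exists (s0 ++ s) => //=; rewrite cat_uniq us0 us andbT.
  by apply/hasPn => t /ss0.
by rewrite big_cat /= => le1; move: lt0; rewrite ltrBlDr; lra.
Qed.
End Summable.

Section Fourier.
Context {R : realType}.
Implicit Types (f : R -> R) (g : R -> R[i]).

(** Continuity of real and imaginary parts, the form in which integrability of a
    complex integrand is needed. *)
Definition ccont g := continuous (fun x => complex.Re (g x)) /\
                      continuous (fun x => complex.Im (g x)).
Local Notation I := (`[- pi, pi]%classic : set R).

Lemma continuous_integrable (u : R -> R) : continuous u ->
  lebesgue_measure.-integrable I (EFin \o u).
Proof.
move=> cu; apply: continuous_compact_integrable; first exact: segment_compact.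
exact: continuous_subspaceT.
Qed.

Lemma complex_ext (z w : R[i]) :
  complex.Re z = complex.Re w -> complex.Im z = complex.Im w -> z = w.
Proof. by case: z w => [? ?] [? ?] /= -> ->. Qed.

Lemma Re_cintegral D g : complex.Re (cintegral D g) =
  \int[lebesgue_measure]_(x in D) complex.Re (g x).
Proof. by []. Qed.

Lemma Im_cintegral D g : complex.Im (cintegral D g) =
  \int[lebesgue_measure]_(x in D) complex.Im (g x).
Proof. by []. Qed.

Lemma cintegralD g1 g2 : ccont g1 -> ccont g2 ->
  cintegral I (fun x => g1 x + g2 x) = cintegral I g1 + cintegral I g2.
Proof.
move=> [/continuous_integrable a1 /continuous_integrable b1].
move=> [/continuous_integrable a2 /continuous_integrable b2].
apply: complex_ext.
  rewrite cReD !Re_cintegral -RintegralD //.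
  by apply: eq_Rintegral => x _; rewrite cReD.
rewrite cImD !Im_cintegral -RintegralD //.
by apply: eq_Rintegral => x _; rewrite cImD.
Qed.

Lemma ccontD g1 g2 : ccont g1 -> ccont g2 -> ccont (fun x => g1 x + g2 x).
Proof.
move=> [a1 b1] [a2 b2]; split.
  by under eq_fun do rewrite cReD; move=> x; apply: cvgD; [exact: a1|exact: a2].
by under eq_fun do rewrite cImD; move=> x; apply: cvgD; [exact: b1|exact: b2].
Qed.

Lemma ccontM g1 g2 : ccont g1 -> ccont g2 -> ccont (fun x => g1 x * g2 x).
Proof.
move=> [a1 b1] [a2 b2]; split.
  under eq_fun do rewrite cReM; move=> x; apply: cvgB; apply: cvgM;
    by [exact: a1|exact: a2|exact: b1|exact: b2].
under eq_fun do rewrite cImM; move=> x; apply: cvgD; apply: cvgM;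
  by [exact: a1|exact: a2|exact: b1|exact: b2].
Qed.

Lemma ccont_real f : continuous f -> ccont (fun x => (f x)%:C).
Proof. by move=> cf; split => // x; exact: cvg_cst. Qed.

Lemma ccont_cst (c : R[i]) : ccont (fun => c).
Proof. by split => x; exact: cvg_cst. Qed.

Lemma ccont_expi (c : R) : ccont (fun x => expi (- (c * x))).
Proof.
have cc : continuous (fun x : R => - (c * x)).
  by move=> x; apply: cvgN; apply: cvgM; [exact: cvg_cst | exact: cvg_id].
split => x; rewrite /expi /=.
  by apply: (@continuous_comp _ _ _ (fun x => - (c * x)) cos);
    [exact: cc | exact: continuous_cos].
by apply: (@continuous_comp _ _ _ (fun x => - (c * x)) sin);
    [exact: cc | exact: continuous_sin].
Qed.

Lemma ccont_sum (J : Type) (s : seq J) (u : J -> R -> R[i]) :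
  (forall j, ccont (u j)) -> ccont (fun x => \sum_(j <- s) u j x).
Proof.
move=> cu; elim: s => [|j s IH].
  by under eq_fun do rewrite big_nil; exact: ccont_cst.
by under eq_fun do rewrite big_cons; exact: ccontD.
Qed.

Lemma cintegralZ c g : ccont g -> cintegral I (fun x => c * g x) = c * cintegral I g.
Proof.
move=> [a b]; have ia := continuous_integrable a; have ib := continuous_integrable b.
have Z k (u : R -> R) : continuous u -> continuous (fun x => k * u x).
  by move=> cu x; apply: cvgM; [exact: cvg_cst | exact: cu].
apply: complex_ext.
  rewrite cReM !Re_cintegral !Im_cintegral.
  rewrite -!RintegralZl // -RintegralB //; try exact/continuous_integrable/Z.
  by apply: eq_Rintegral => x _; rewrite cReM.
rewrite cImM !Re_cintegral !Im_cintegral.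
  rewrite -!RintegralZl // -RintegralD //; try exact/continuous_integrable/Z.
by apply: eq_Rintegral => x _; rewrite cImM.
Qed.

Lemma cintegral_sum (J : Type) (s : seq J) (u : J -> R -> R[i]) :
  (forall j, ccont (u j)) ->
  cintegral I (fun x => \sum_(j <- s) u j x) = \sum_(j <- s) cintegral I (u j).
Proof.
move=> cu; elim: s => [|j s IH].
  rewrite big_nil -[RHS](mul0r (cintegral I (fun=> 0))).
  rewrite -cintegralZ; last exact: ccont_cst.
  by congr cintegral; apply/funext => x; rewrite big_nil mul0r.
rewrite big_cons -IH -cintegralD //; last exact: ccont_sum.
by congr cintegral; apply/funext => x; rewrite big_cons.
Qed.

Lemma cintegral_real (u : R -> R) :
  cintegral I (fun x => (u x)%:C) = (\int[lebesgue_measure]_(x in I) u x)%:C.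
Proof.
apply: complex_ext => //.
by rewrite Im_cintegral /Rintegral integral0_eq.
Qed.

Lemma expiD (x y : R) : expi (x + y) = expi x * expi y.
Proof. by rewrite /expi; simpc; rewrite cosD sinD; congr (_ +i* _); ring. Qed.

Lemma expiN (x : R) : expi (- x) = conjc (expi x).
Proof. by rewrite /expi /= cosN sinN. Qed.

Lemma expi0 : expi (0 : R) = 1.
Proof. by rewrite /expi cos0 sin0. Qed.

Lemma conjc_scale (x : R) (z : R[i]) : conjc (x%:C * z) = x%:C * conjc z.
Proof. by case: z => a b; apply: complex_ext => /=; ring. Qed.

Lemma cRe_conj (z : R[i]) : complex.Re (conjc z) = complex.Re z.
Proof. by case: z. Qed.

Lemma cIm_conj (z : R[i]) : complex.Im (conjc z) = - complex.Im z.
Proof. by case: z. Qed.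

Lemma fourierN f k : continuous f -> fourier f (- k) = conjc (fourier f k).
Proof.
move=> cf; pose g j (x : R) := (f x)%:C * expi (- (j%:~R * x)).
rewrite /fourier conjc_scale; congr (_ * _).
change (cintegral I (g (- k)) = conjc (cintegral I (g k))).
set g1 := g (- k); set g2 := g k.
have c2 : ccont g2 by apply: ccontM; [exact: ccont_real | exact: ccont_expi].
have gE x : g1 x = conjc (g2 x).
  by rewrite /g1 /g2 /g conjc_scale -expiN intrN mulNr.
have [_ ci] := c2; have ii := continuous_integrable ci.
apply: complex_ext.
  rewrite cRe_conj !Re_cintegral.
  by apply: eq_Rintegral => x _; rewrite gE cRe_conj.
rewrite cIm_conj !Im_cintegral -[RHS]mulN1r -RintegralZl //.
by apply: eq_Rintegral => x _; rewrite gE cIm_conj mulN1r.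
Qed.

End Fourier.

Section ToeplitzForm.
Context {R : realType}.
Implicit Types (f : R -> R) (g : R -> R[i]).
Local Notation I := (`[- pi, pi]%classic : set R).

Lemma Rintegral_derive (u F : R -> R) : continuous u ->
  (forall x : R, is_derive x 1 F (u x)) ->
  \int[lebesgue_measure]_(x in I) u x = F pi - F (- pi).
Proof.
move=> cu dF; have cF : continuous F.
  by move=> x; apply/differentiable_continuous/derivable1_diffP; case: (dF x).
rewrite /Rintegral (@continuous_FTC2 _ u F) //.
- by have := pi_gt0 R; lra.
- exact: continuous_subspaceT.
- split; first by move=> x _; case: (dF x).
  + by apply: cvg_at_right_filter; exact: cF.
  + by apply: cvg_at_left_filter; exact: cF.
- by move=> x _; rewrite derive1E; case: (dF x).
Qed.

Lemma sin_intpi (k : int) : sin (k%:~R * pi) = 0 :> R.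
Proof.
have nat_case (m : nat) : sin (m%:R * pi) = 0 :> R.
  elim: m => [|m IH]; first by rewrite mul0r sin0.
  by rewrite -natr1 mulrDl mul1r sinD IH sinpi mul0r mulr0 addr0.
by case: k => m; rewrite ?NegzE ?mulrNz ?mulNr ?sinN nat_case ?oppr0.
Qed.

(** Orthogonality of the exponentials: the Toeplitz matrix of the constant
    function 1 is the identity. *)
Lemma fourier1 (k : int) : fourier (fun=> 1 : R) k = (k == 0)%:R.
Proof.
rewrite /fourier.
have [->|k0] := eqVneq k 0.
  have -> : (fun x : R => 1%:C * expi (- (0%:~R * x))) = (fun x => (1 : R)%:C).
    by apply/funext => x; rewrite mul0r oppr0 expi0 mulr1.
  have mI : fine (lebesgue_measure I) = 2 * pi :> R.
    rewrite lebesgue_measure_itv ifT; last first.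
      by rewrite lte_fin; have := pi_gt0 R; lra.
    by rewrite -EFinB; have -> : pi - - pi = 2 * pi :> R by ring.
  rewrite cintegral_real Rintegral_cst // [fine _]mI mul1r -rmorphM /=.
  by rewrite mulVf // mulf_neq0 // gt_eqF // pi_gt0.
rewrite /= [cintegral _ _](_ : _ = 0) ?mulr0 //.
pose c : R := - k%:~R; have c0 : c != 0 by rewrite oppr_eq0 intr_eq0.
have spi : sin (c * pi) = 0 by rewrite /c mulNr sinN sin_intpi oppr0.
have dc (x : R) : is_derive x 1 (fun y => c * y) c.
  by apply: is_derive_eq; rewrite /GRing.scale /= mulr1.
have cc : continuous (fun x : R => c * x).
  by move=> x; apply: cvgM; [exact: cvg_cst | exact: cvg_id].
have ccos : continuous (fun x => cos (c * x)).
  by move=> x; apply: (@continuous_comp _ _ _ (fun x => c * x) cos);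
    [exact: cc | exact: continuous_cos].
have csin : continuous (fun x => sin (c * x)).
  by move=> x; apply: (@continuous_comp _ _ _ (fun x => c * x) sin);
    [exact: cc | exact: continuous_sin].
apply: complex_ext.
  transitivity (\int[lebesgue_measure]_(x in I) cos (c * x)).
    by apply: eq_Rintegral => x _; rewrite mul1r /c mulNr.
  have dF (x : R) : is_derive x 1 (fun y => c^-1 * sin (c * y)) (cos (c * x)).
    have ds := @is_derive1_comp _ (@sin R) (fun y => c * y) x _ _
      (is_derive_sin _) (dc x).
    apply: (@is_derive_eq _ _ _ _ _ _ _ _ (is_deriveZ _ ds)).
    by rewrite /GRing.scale /= mulrC -mulrA mulfV ?mulr1.
  by rewrite (Rintegral_derive ccos dF) mulrN sinN spi oppr0 subrr.
transitivity (\int[lebesgue_measure]_(x in I) sin (c * x)).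
  by apply: eq_Rintegral => x _; rewrite mul1r /c mulNr.
have dF (x : R) : is_derive x 1 (fun y => - c^-1 * cos (c * y)) (sin (c * x)).
  have ds := @is_derive1_comp _ (@cos R) (fun y => c * y) x _ _
      (is_derive_cos _) (dc x).
  apply: (@is_derive_eq _ _ _ _ _ _ _ _ (is_deriveZ _ ds)).
  by rewrite /GRing.scale /= [- _ * c]mulNr mulrNN mulrC -mulrA mulfV ?mulr1.
by rewrite (Rintegral_derive csin dF) mulrN cosN subrr.
Qed.

Definition trigpoly n (v : 'rV[R[i]]_n) (x : R) : R[i] :=
  \sum_j v 0 j * expi (- ((j%:Z)%:~R * x)).

Lemma ccont_trigpoly n (v : 'rV[R[i]]_n) : ccont (trigpoly v).
Proof.
by apply: ccont_sum => j; apply: ccontM; [exact: ccont_cst | exact: ccont_expi].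
Qed.

Lemma conjcM (z w : R[i]) : conjc (z * w) = conjc z * conjc w.
Proof. exact: rmorphM. Qed.

Lemma conjcM_normc (z : R[i]) : z * conjc z = (normc z ^+ 2)%:C.
Proof. by rewrite rmorphXn /= -normCE normCK. Qed.

(** Both sides are the integral of f(x) times the double sum of the
    v_j conj(v_k) exp(- i (j - k) x), which is |trigpoly v x|^2. *)
Lemma toeplitz_form f n (v : 'rV[R[i]]_n) : continuous f ->
  (v *m toeplitz f n *m v ^t*) 0 0 =
  ((2 * pi)^-1 *
   \int[lebesgue_measure]_(x in I) (f x * normc (trigpoly v x) ^+ 2))%:C.
Proof.
move=> cf; rewrite rmorphM /= -cintegral_real.
pose e (j k : 'I_n) (x : R) :=
  (f x)%:C * expi (- ((j%:Z - k%:Z)%:~R * x)).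
have ce j k : ccont (e j k).
  by apply: ccontM; [exact: ccont_real | exact: ccont_expi].
have cce (c : R[i]) j k : ccont (fun x => c * e j k x).
  by apply: ccontM => //; exact: ccont_cst.
transitivity ((2 * pi)^-1%:C * cintegral I (fun x : R =>
    \sum_k \sum_j (v 0 j * conjc (v 0 k)) * e j k x)).
  rewrite cintegral_sum; last by move=> k; exact: ccont_sum.
  rewrite mxE mulr_sumr; apply: eq_bigr => k _.
  rewrite cintegral_sum // mxE mulr_suml mulr_sumr; apply: eq_bigr => j _.
  rewrite !mxE /fourier cintegralZ // -/(e j k) -conjCE.
  rewrite -[cintegral _ (e j k)]/(cintegral I (e j k)).
  by ring.
congr (_ * cintegral _ _); apply/funext => x.
have conj_p : conjc (trigpoly v x) = \sum_k conjc (v 0 k) * expi ((k%:Z)%:~R * x).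
  rewrite rmorph_sum; apply: eq_bigr => k _.
  by rewrite -[LHS]/(conjc (_ * _)) conjcM -expiN opprK.
rewrite rmorphM /= -conjcM_normc conj_p /trigpoly.
rewrite big_distrlr /= exchange_big mulr_sumr; apply: eq_bigr => k _.
rewrite mulr_sumr; apply: eq_bigr => j _.
by rewrite /e intrB mulrBl opprB addrC expiD; ring.
Qed.

(** Parseval's identity, obtained as [toeplitz_form] for the constant function 1. *)
Lemma sqn_form n (v : 'rV[R[i]]_n) :
  sqn v = ((2 * pi)^-1 *
    \int[lebesgue_measure]_(x in I) (normc (trigpoly v x) ^+ 2))%:C.
Proof.
have c1 : continuous (fun _ : R => 1 : R) by move=> x; exact: cvg_cst.
transitivity ((v *m toeplitz (fun=> 1) n *m v ^t*) 0 0); last first.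
  rewrite toeplitz_form //; congr (_ * _)%:C.
  by congr Rintegral; apply/funext => x; rewrite mul1r.
rewrite sqnE; congr ((_ *m _) 0 0).
rewrite (_ : toeplitz _ n = 1%:M) ?mulmx1 //.
by apply/matrixP => j k; rewrite !mxE fourier1 subr_eq0 eqz_nat.
Qed.

Lemma toeplitz_rayleigh f n (v : 'rV[R[i]]_n) (M : R) : continuous f ->
  (forall x, x \in I -> 0 <= f x <= M) ->
  0 <= (v *m toeplitz f n *m v ^t*) 0 0 <= M%:C * sqn v.
Proof.
move=> cf fM; have p0 : 0 <= (2 * pi : R)^-1.
  by rewrite invr_ge0 mulr_ge0 // ltW // pi_gt0.
have cn : continuous (fun x => normc (trigpoly v x) ^+ 2).
  have [a b] := ccont_trigpoly v.
  have -> : (fun x => normc (trigpoly v x) ^+ 2) = (fun x =>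
     complex.Re (trigpoly v x) * complex.Re (trigpoly v x) +
     complex.Im (trigpoly v x) * complex.Im (trigpoly v x)).
    apply/funext => x; case: (trigpoly v x) => s t /=.
    by rewrite sqr_sqrtr // addr_ge0 ?sqr_ge0.
  by move=> x; apply: cvgD; apply: cvgM; by [exact: a | exact: b].
have cM (u : R -> R) : continuous u ->
    continuous (fun x => u x * normc (trigpoly v x) ^+ 2).
  by move=> cu x; apply: cvgM; [exact: cu | exact: cn].
rewrite toeplitz_form // sqn_form -rmorphM /= ler0c lecR mulrCA.
rewrite mulr_ge0 //=; last first.
  apply: Rintegral_ge0 => x /mem_set /fM /andP[f0 _].
  by rewrite mulr_ge0 // exprn_ge0 // normc_ge0.
rewrite ler_wpM2l // -RintegralZl //; last exact: continuous_integrable.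
apply: le_Rintegral => //.
- exact/continuous_integrable/cM.
- by apply: continuous_integrable; apply: cM => x; exact: cvg_cst.
move=> x /mem_set /fM /andP[_ fM'].
by rewrite ler_wpM2r // exprn_ge0 // normc_ge0.
Qed.

Lemma toeplitz_hermitian f n : continuous f -> (toeplitz f n) ^t* = toeplitz f n.
Proof.
move=> cf; apply/matrixP => j k; rewrite !mxE.
by rewrite conjCE -fourierN // opprB.
Qed.

Lemma le_fmax f x : continuous f -> x \in I -> f x <= fmax f.
Proof.
move=> cf /set_mem xI; apply: ub_le_sup; last by exists x.
have lepi : - pi <= pi :> R by have := pi_gt0 R; lra.
have [c _ cmax] := EVT_max lepi (continuous_subspaceT cf).
by exists (f c) => _ [y yI <-]; exact: cmax.
Qed.

End ToeplitzForm.

(** * Diagonalization of the circulant matrix *)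

Section Circulant.
Context {R : realType}.
Implicit Types (f : R -> R).

Lemma expiX (x : R) k : expi x ^+ k = expi (k%:R * x).
Proof.
elim: k => [|k IH]; first by rewrite mul0r expi0 expr0.
by rewrite exprS IH -expiD -natr1 mulrDl mul1r addrC.
Qed.

Lemma expi_2pi : expi (2 * pi) = 1 :> R[i].
Proof. by rewrite /expi mulr_natl cos2pi sin2pi. Qed.

(** From cos t = 1 the half-angle formula gives sin (t / 2) = 0, impossible for
    0 < t / 2 < pi. *)
Lemma expi_neq1 (t : R) : 0 < t < 2 * pi -> expi t != 1.
Proof.
move=> /andP[t0 tpi]; apply/eqP => /(congr1 (@complex.Re R)) /= ct.
have s0 : 0 < sin (t / 2) by apply: sin_gt0_pi; apply/andP; split; lra.
have : cos (t / 2 + t / 2) = 1 by rewrite -[RHS]ct; congr cos; lra.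
rewrite cosD; have := cos2Dsin2 (t / 2); rewrite !expr2.
by have := mulr_gt0 s0 s0; lra.
Qed.

Lemma normc_expi (x : R) : normc (expi x) = 1.
Proof. by rewrite /expi /= cos2Dsin2 sqrtr1. Qed.

(** The off-diagonal entries of the product are geometric sums over the powers
    of an n-th root of unity different from 1. *)
Lemma fourier_mx_unitary n : (0 < n)%N -> fourier_mx R n \is unitarymx.
Proof.
move=> n0; have nR : 0 < n%:R :> R by rewrite ltr0n.
have p2 : 0 < 2 * pi :> R by rewrite mulr_gt0 // pi_gt0.
have geom (m : nat) : (0 < m < n)%N ->
    \sum_(k < n) expi (k%:R * (2 * pi * m%:R / n%:R)) = 0 :> R[i].
  move=> /andP[m0 mn]; set t := _ / _.
  have t1 : expi t != 1.
    apply: expi_neq1; rewrite divr_gt0 ?mulr_gt0 ?ltr0n ?pi_gt0 //=.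
    by rewrite ltr_pdivrMr // ltr_pM2l // ltr_nat.
  under eq_bigr do rewrite -expiX.
  have tn : expi t ^+ n = 1.
    rewrite expiX (_ : _ * _ = m%:R * (2 * pi)).
      by rewrite -expiX expi_2pi expr1n.
    by rewrite /t; field; rewrite gt_eqF.
  have /esym/eqP := subrX1 (expi t) n.
  by rewrite tn subrr mulf_eq0 subr_eq0 (negbTE t1) => /eqP.
apply/unitarymxP/matrixP => j l; rewrite !mxE.
have e (k : 'I_n) : fourier_mx R n j k * (fourier_mx R n ^t*) k l =
    (n%:R^-1)%:C * expi (k%:R * (2 * pi * (l%:R - j%:R) / n%:R)).
  rewrite !mxE conjCE conjc_scale -expiN opprK mulrACA -expiD -rmorphM /= -invfM.
  rewrite -expr2 sqr_sqrtr ?ler0n //; congr (_ * expi _).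
  by field; rewrite gt_eqF.
rewrite (eq_bigr _ (fun k _ => e k)) -mulr_sumr.
have [->|jl] := eqVneq j l.
  rewrite subrr mulr0 mul0r; under eq_bigr do rewrite mulr0 expi0.
  rewrite sumr_const card_ord -(rmorph_nat (real_complex R)) -rmorphM /=.
  by rewrite mulVf ?gt_eqF // eqxx.
rewrite [X in _ * X](_ : _ = 0) ?mulr0 //.
have [lt_jl|lt_lj|/val_inj eq_jl] := ltngtP j l; last by rewrite eq_jl eqxx in jl.
- rewrite -[RHS](geom (l - j)%N); last first.
    by rewrite subn_gt0 lt_jl /= (leq_ltn_trans (leq_subr _ _)).
  by apply: eq_bigr => k _; rewrite natrB // ltnW.
- apply: (can_inj (@conjcK R)); rewrite conjc0 rmorph_sum /= -[RHS](geom (j - l)%N).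
    apply: eq_bigr => k _; rewrite -[LHS]/(conjc (expi _)) -expiN.
    rewrite natrB ?(ltnW lt_lj) //.
    by congr expi; rewrite -mulrN -mulNr -mulrN opprB.
  by rewrite subn_gt0 lt_lj /= (leq_ltn_trans (leq_subr _ _)).
Qed.

(** The reflection k |-> p - k modulo n is an involution; it reindexes the
    circular convolution below. *)
Lemma ord_reflK n (p k : 'I_n) : ((p + n - (p + n - k) %% n) %% n = k)%N.
Proof.
have := ltn_ord p; have := ltn_ord k => kn pn.
have [kp|pk] := leqP k p.
  have -> : ((p + n - k) %% n = p - k)%N.
    by rewrite -addnBAC // modnDr modn_small //; lia.
  have -> : (p + n - (p - k) = k + n)%N by lia.
  by rewrite modnDr modn_small.
rewrite [((p + n - k) %% n)%N]modn_small; last lia.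
have -> : (p + n - (p + n - k) = k)%N by lia.
by rewrite modn_small.
Qed.

(** The discrete Fourier transform of the first column; the exponent n - m stands
    for - m, the base being an n-th root of unity. *)
Definition strang_eig f n : 'rV[R[i]]_n := \row_l \sum_(m < n)
  strang_coef f n m * expi (2 * pi * l%:R / n%:R) ^+ (n - m).

Lemma strang_eigen f n : (0 < n)%N -> let U := fourier_mx R n in
  strang f n = U ^t* *m diag_mx (strang_eig f n) *m U.
Proof.
move=> n0 U; have uU := fourier_mx_unitary n0.
have nR : n%:R != 0 :> R by rewrite pnatr_eq0 -lt0n.
set lam := strang_eig f n.
suff SU : strang f n *m U ^t* = U ^t* *m diag_mx lam.
  rewrite -SU -mulmxA.
  have -> : U ^t* *m U = 1%:M.
    by rewrite -{2}(trmxCK U); apply/unitarymxP; rewrite trmxC_unitary.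
  by rewrite mulmx1.
apply/matrixP => p l.
pose z : R[i] := expi (2 * pi * l%:R / n%:R).
have zn : z ^+ n = 1.
  rewrite expiX (_ : _ * _ = l%:R * (2 * pi)); last by field.
  by rewrite -expiX expi_2pi expr1n.
have Uz (k : 'I_n) : (U ^t*) k l = (Num.sqrt n%:R)^-1%:C * z ^+ k.
  rewrite !mxE conjCE conjc_scale -expiN opprK expiX; congr (_ * expi _).
  by field.
have -> : (U ^t* *m diag_mx lam) p l = (U ^t*) p l * lam 0 l.
  by rewrite mul_mx_diag mxE.
rewrite mxE (eq_bigr (fun k : 'I_n => (Num.sqrt n%:R)^-1%:C *
    (strang_coef f n ((p + n - k) %% n) * z ^+ k))); last first.
  by move=> k _; rewrite Uz mxE mulrCA.
rewrite -mulr_sumr Uz -mulrA; congr (_ * _); rewrite /lam mxE.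
rewrite mulr_sumr.
(* The product is a circular convolution of the coefficients with the powers
   of z; it is turned into a multiple of z^p by reflecting k. *)
have rn k : ((p + n - k) %% n < n)%N by rewrite ltn_mod.
pose rho (k : 'I_n) := Ordinal (rn k).
have rhoK : involutive rho by move=> k; apply: val_inj; rewrite /= ord_reflK.
rewrite [RHS](reindex_inj (inv_inj rhoK)) /=; apply: eq_bigr => k _.
rewrite mulrCA; congr (_ * _); rewrite -/z -exprD addnBA; last by rewrite ltnW.
rewrite -(expr_mod _ zn) -[in RHS](expr_mod _ zn); congr (_ ^+ _).
by rewrite ord_reflK modn_small.
Qed.

End Circulant.

(** * Toeplitz minus circulant *)

Section Comparison.
Context {R : realType} (f : R -> R).
Context (cf : continuous f).

Lemma conjcD (z w : R[i]) : conjc (z + w) = conjc z + conjc w.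
Proof. exact: (rmorphD (@conjc R)). Qed.

Lemma strang_coef_conj n m : (0 < m < n)%N ->
  conjc (strang_coef f n m) = strang_coef f n (n - m)%N.
Proof.
move=> /andP[m0 mn]; rewrite /strang_coef.
have nm : (n - m)%N%:Z = n%:Z - m%:Z by rewrite -subzn // ltnW.
have [lt|lt|eq] := ltngtP m.*2 n.
- rewrite (_ : ((n - m).*2 < n)%N = false); last lia.
  rewrite (_ : (n < (n - m).*2)%N = true); last lia.
  by rewrite -fourierN // nm addrAC subrr sub0r.
- rewrite (_ : ((n - m).*2 < n)%N = true); last lia.
  by rewrite -fourierN // nm opprB.
- have -> : (n - m = m)%N by lia.
  rewrite -eq !ltnn conjcM.
  rewrite (_ : conjc 2^-1 = 2^-1); last by rewrite fmorphV rmorph_nat.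
  by rewrite conjcD -!fourierN // opprK addrC.
Qed.

Lemma strang_hermitian n : (strang f n) ^t* = strang f n.
Proof.
apply/matrixP => j k; rewrite !mxE conjCE.
have [jn kn] := (ltn_ord j, ltn_ord k).
have [lt|lt|eq] := ltngtP j k.
- have -> : ((k + n - j) %% n = k - j)%N.
    by rewrite -addnBAC ?(ltnW lt) // modnDr modn_small //; lia.
  rewrite strang_coef_conj; last lia.
  rewrite modn_small; last lia.
  by congr strang_coef; lia.
- have -> : ((j + n - k) %% n = j - k)%N.
    by rewrite -addnBAC ?(ltnW lt) // modnDr modn_small //; lia.
  rewrite modn_small; last lia.
  rewrite strang_coef_conj; last lia.
  by congr strang_coef; lia.
- rewrite eq addKn modnn /strang_coef double0 (leq_ltn_trans _ kn) //.
  by rewrite -fourierN // oppr0.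
Qed.

Definition coef_tail (N0 : nat) (i : int) : R :=
  if (N0 < `|i|)%N then normc (fourier f i) else 0.

Lemma coef_tail_ge0 N0 i : 0 <= coef_tail N0 i.
Proof. by rewrite /coef_tail; case: ifP => // _; exact: normc_ge0. Qed.

Lemma coef_tailE N0 i : (N0 < `|i|)%N -> coef_tail N0 i = normc (fourier f i).
Proof. by rewrite /coef_tail => ->. Qed.

Lemma le_normcB (z w : R[i]) : normc (z - w) <= normc z + normc w.
Proof. by apply: le_trans (le_normcD _ _) _; rewrite normcN. Qed.

Lemma normc_half (z : R[i]) : normc (z / 2) <= normc z.
Proof.
rewrite normcM normcV ler_piMr ?normc_ge0 //.
have -> : normc (2 : R[i]) = 2.
  by apply: complexI; rewrite -normCE ger0_norm // rmorph_nat.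
by rewrite invf_le1 ?ltr0n // ler1n.
Qed.

(** On the diagonal d = j - k the matrices agree if 2 |d| < n.  Otherwise the
    circulant wraps around and uses the coefficient of index d - n or d + n
    instead of d, or the average of the two if 2 |d| = n.  Away from the first N0
    rows and columns |d| < n - N0, so that the indices involved all exceed N0 in
    modulus. *)
Lemma strang_diff_entry n (j k : 'I_n) N0 : (N0.*2 < n)%N ->
  (N0 <= j)%N -> (N0 <= k)%N ->
  normc ((toeplitz f n - strang f n) j k) <=
  coef_tail N0 (j%:Z - k%:Z) + coef_tail N0 (j%:Z - k%:Z - n%:Z) +
  coef_tail N0 (j%:Z - k%:Z + n%:Z).
Proof.
move=> N0n Nj Nk; set d := j%:Z - k%:Z; rewrite !mxE -/d.
have [jn kn] := (ltn_ord j, ltn_ord k).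
have t0 := coef_tail_ge0 N0.
have zero : forall z, z = 0 ->
    normc z <= coef_tail N0 d + coef_tail N0 (d - n%:Z) + coef_tail N0 (d + n%:Z).
  by move=> z ->; rewrite normc0 !addr_ge0.
have [lt|lt|eq] := ltngtP j k.
- have -> : ((j + n - k) %% n = n - (k - j))%N by rewrite modn_small; lia.
  rewrite /strang_coef.
  have [lt2|lt2|eq2] := ltngtP (n - (k - j)).*2 n.
  + have -> : (n - (k - j))%N%:Z = d + n%:Z by rewrite /d; lia.
    apply: le_trans (le_normcB _ _) _.
    rewrite -!(@coef_tailE N0); [|rewrite /d; lia|rewrite /d; lia].
    by have := t0 (d - n%:Z); lra.
  + have -> : (n - (k - j))%N%:Z - n%:Z = d by rewrite /d; lia.
    by apply: zero; rewrite subrr.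
  + have -> : (n - (k - j))%N%:Z = d + n%:Z by rewrite /d; lia.
    have -> : - (d + n%:Z) = d by rewrite /d; lia.
    have -> : fourier f d - (fourier f (d + n%:Z) + fourier f d) / 2 =
      (fourier f d - fourier f (d + n%:Z)) / 2 by field.
    apply: le_trans (normc_half _) _; apply: le_trans (le_normcB _ _) _.
    rewrite -!(@coef_tailE N0); [|rewrite /d; lia|rewrite /d; lia].
    by have := t0 (d - n%:Z); lra.
- have -> : ((j + n - k) %% n = j - k)%N.
    by rewrite -addnBAC ?(ltnW lt) // modnDr modn_small //; lia.
  rewrite /strang_coef.
  have dE : (j - k)%N%:Z = d by rewrite /d; lia.
  have [lt2|lt2|eq2] := ltngtP (j - k).*2 n.
  + by apply: zero; rewrite dE subrr.
  + rewrite dE; apply: le_trans (le_normcB _ _) _.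
    rewrite -!(@coef_tailE N0); [|rewrite /d; lia|rewrite /d; lia].
    by have := t0 (d + n%:Z); lra.
  + have -> : - (j - k)%N%:Z = d - n%:Z by rewrite /d; lia.
    rewrite dE.
    have -> : fourier f d - (fourier f d + fourier f (d - n%:Z)) / 2 =
      (fourier f d - fourier f (d - n%:Z)) / 2 by field.
    apply: le_trans (normc_half _) _; apply: le_trans (le_normcB _ _) _.
    rewrite -!(@coef_tailE N0); [|rewrite /d; lia|rewrite /d; lia].
    by have := t0 (d + n%:Z); lra.
- apply: zero; rewrite /d eq addKn modnn /strang_coef double0.
  rewrite (leq_ltn_trans _ kn) //.
  by rewrite !subrr.
Qed.

Context (f_summable : summable [set: int] (fun k => (normc (fourier f k))%:E)).

Lemma coef_tail_sum (delta : R) : 0 < delta -> exists N0 : nat,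
  forall n (u : 'I_n -> int), injective u -> \sum_i coef_tail N0 (u i) <= delta.
Proof.
move=> d0; have [s0 s0P] :=
  summable_seq_tail (fun k => normc_ge0 (fourier f k)) f_summable d0.
exists (\max_(i <- s0) `|i|)%N => n u uI.
rewrite -(big_map u predT (coef_tail _)) /coef_tail -big_mkcond -big_filter.
apply: s0P.
  by rewrite filter_uniq // map_inj_uniq // index_enum_uniq.
move=> t; rewrite mem_filter => /andP[tN _]; apply/negP => ts0.
by move: tN; rewrite ltnNge (@leq_bigmax_seq _ _ xpredT (fun i : int => `|i|%N)).
Qed.

Lemma coef_sum_bound : exists B : R, 0 <= B /\
  forall n (u : 'I_n -> int), injective u -> \sum_i coef_tail 0 (u i) <= B.
Proof.
have [B BP] := summable_seq_bound (fun k => normc_ge0 (fourier f k)) f_summable.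
exists B; split; first by have := BP [::] isT; rewrite big_nil.
move=> n u uI.
rewrite -(big_map u predT (coef_tail _)) /coef_tail -big_mkcond -big_filter.
by apply: BP; rewrite filter_uniq // map_inj_uniq // index_enum_uniq.
Qed.

(** Along a row the indices j - k, j - k - n and j - k + n are each injective in
    k, so each of the three sums is a sum over distinct coefficients. *)
Lemma coef_tail_row_sum n (j : 'I_n) N0 (delta : R) :
  (forall u : 'I_n -> int, injective u -> \sum_i coef_tail N0 (u i) <= delta) ->
  \sum_(k < n) (coef_tail N0 (j%:Z - k%:Z) + coef_tail N0 (j%:Z - k%:Z - n%:Z) +
    coef_tail N0 (j%:Z - k%:Z + n%:Z)) <= 3 * delta.
Proof.
move=> H; rewrite !big_split /=.
have h1 : \sum_(k < n) coef_tail N0 (j%:Z - k%:Z) <= delta.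
  by apply: H => a b /= e; apply: ord_inj; lia.
have h2 : \sum_(k < n) coef_tail N0 (j%:Z - k%:Z - n%:Z) <= delta.
  by apply: H => a b /= e; apply: ord_inj; lia.
have h3 : \sum_(k < n) coef_tail N0 (j%:Z - k%:Z + n%:Z) <= delta.
  by apply: H => a b /= e; apply: ord_inj; lia.
by lra.
Qed.

Lemma coef_tail_col_sum n (k : 'I_n) N0 (delta : R) :
  (forall u : 'I_n -> int, injective u -> \sum_i coef_tail N0 (u i) <= delta) ->
  \sum_(j < n) (coef_tail N0 (j%:Z - k%:Z) + coef_tail N0 (j%:Z - k%:Z - n%:Z) +
    coef_tail N0 (j%:Z - k%:Z + n%:Z)) <= 3 * delta.
Proof.
move=> H; rewrite !big_split /=.
have h1 : \sum_(j < n) coef_tail N0 (j%:Z - k%:Z) <= delta.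
  by apply: H => a b /= e; apply: ord_inj; lia.
have h2 : \sum_(j < n) coef_tail N0 (j%:Z - k%:Z - n%:Z) <= delta.
  by apply: H => a b /= e; apply: ord_inj; lia.
have h3 : \sum_(j < n) coef_tail N0 (j%:Z - k%:Z + n%:Z) <= delta.
  by apply: H => a b /= e; apply: ord_inj; lia.
by lra.
Qed.

Lemma toeplitz_strang_essentially_small :
  essentially_small (fun n => toeplitz f n - strang f n).
Proof.
move=> _ /[dup] /gtr0_real /complex_realP [eps ->]; rewrite ltcR => eps0.
(* Chosen so that the bound (3 delta)^2 given by Schur's test is at most eps. *)
pose delta := Num.min 1 (eps / 9).
have d0 : 0 < delta by rewrite lt_min ltr01 /= divr_gt0 // ltr0n.
have d9 : (3 * delta) ^+ 2 <= eps.
  have d1 : delta <= 1 by rewrite /delta ge_min lexx.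
  have d2 : delta <= eps / 9 by rewrite /delta ge_min lexx orbT.
  have : delta * delta <= 1 * (eps / 9) by apply: ler_pM => //; exact: ltW.
  by rewrite exprMn expr2; lra.
have [N0 N0P] := coef_tail_sum d0.
exists (N0 + N0)%N, N0.*2 => n nN; set D := _ - _.
have N0n : (N0 <= n)%N by lia.
exists (trim N0 D), (D - trim N0 D).
split; [by rewrite addrC subrK | | exact: rank_sub_trim].
have Ele j k : `|trim N0 D j k| <=
    (coef_tail N0 (j%:Z - k%:Z) + coef_tail N0 (j%:Z - k%:Z - n%:Z) +
      coef_tail N0 (j%:Z - k%:Z + n%:Z))%:C.
    rewrite mxE; case: ifP => [/andP[Nj Nk]|_].
      by rewrite normCE lecR strang_diff_entry.
    by rewrite normr0 ler0c !addr_ge0 // coef_tail_ge0.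
  apply: opnorm_sq_leW (opnorm_sq_le_schur (c := (3 * delta)%:C) _ _ _).
  + by rewrite -rmorphXn lecR.
  + by rewrite ler0c mulr_ge0 // ltW.
  + move=> j; apply: le_trans (ler_sum _ (fun k _ => Ele j k)) _.
    by rewrite -rmorph_sum lecR; apply: coef_tail_row_sum; exact: N0P.
  + move=> k; apply: le_trans (ler_sum _ (fun j _ => Ele j k)) _.
    by rewrite -rmorph_sum lecR; apply: coef_tail_col_sum; exact: N0P.
Qed.

(** The mean absolute row sum of A - S tends to 0: outside the first N0 rows and
    columns it is controlled by the tail of the coefficients, and those 2 N0 rows
    and columns contribute a bounded amount each, hence O(1/n) to the mean. *)
Lemma diff_total_sum (eps : R) : 0 < eps -> exists N : nat, forall n, (N < n)%N ->
  \sum_(j < n) \sum_(k < n) normc ((toeplitz f n - strang f n) j k) <= eps * n%:R.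
Proof.
move=> e0; have [B [B0 BP]] := coef_sum_bound.
have d0 : 0 < eps / 6 by rewrite divr_gt0 // ltr0n.
have [N0 N0P] := coef_tail_sum d0.
pose X := N0%:R * (3 * B) * 2 / (eps / 2).
have X0 : 0 <= X by rewrite divr_ge0 ?mulr_ge0 ?ler0n ?invr_ge0 ?ler0n ?(ltW e0).
exists (N0.*2 + Num.truncn X).+1 => n nN.
have N0n : (N0 <= n)%N by lia.
have N02 : (N0.*2 < n)%N by lia.
have n0 : (0 < n)%N by lia.
have Xn : X <= n%:R.
  have := real_truncnS_gt (ger0_real X0).
  by move=> /ltW /le_trans; apply; rewrite ler_nat; lia.
set D := fun j k : 'I_n => normc ((toeplitz f n - strang f n) j k).
have D0 j k : 0 <= D j k by exact: normc_ge0.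
have row j : \sum_k D j k <= 3 * B.
  apply: le_trans (coef_tail_row_sum (N0 := 0) j (BP n)).
  by apply: ler_sum => k _; apply: strang_diff_entry.
have col k : \sum_j D j k <= 3 * B.
  apply: le_trans (coef_tail_col_sum (N0 := 0) k (BP n)).
  by apply: ler_sum => j _; apply: strang_diff_entry.
pose G (j k : 'I_n) := coef_tail N0 (j%:Z - k%:Z) +
      coef_tail N0 (j%:Z - k%:Z - n%:Z) +
      coef_tail N0 (j%:Z - k%:Z + n%:Z).
have G0 j k : 0 <= G j k by rewrite !addr_ge0 // coef_tail_ge0.
have few (c : R) : \sum_(j < n) (if (j < N0)%N then c else 0) = N0%:R * c.
  by rewrite -big_mkcond (big_ord_narrow N0n) sumr_const card_ord -[LHS]mulr_natl.
have le1 : \sum_(j < n) \sum_(k < n) D j k <= \sum_(j < n) \sum_(k < n) G j k +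
    \sum_(j < n) (if (j < N0)%N then \sum_(k < n) D j k else 0) +
    \sum_(k < n) (if (k < N0)%N then \sum_(j < n) D j k else 0).
  have -> : \sum_(k < n) (if (k < N0)%N then \sum_(j < n) D j k else 0) =
      \sum_(j < n) \sum_(k < n) (if (k < N0)%N then D j k else 0).
    rewrite exchange_big; apply: eq_bigr => k _; case: ifP => // _.
    by rewrite big1.
  rewrite -!big_split /=; apply: ler_sum => j _.
  case: (ltnP j N0) => jN.
    by rewrite -addrA addrCA lerDl addr_ge0 ?sumr_ge0 // => k _; case: ifP.
  rewrite addr0 -big_split /=; apply: ler_sum => k _.
  case: (ltnP k N0) => kN; first by rewrite lerDr.
  by rewrite addr0; exact: strang_diff_entry.
apply: (le_trans le1).
have sG : \sum_(j < n) \sum_(k < n) G j k <= n%:R * (eps / 2).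
  apply: le_trans (ler_sum _ (fun j _ => coef_tail_row_sum j (N0P n))) _.
  by rewrite sumr_const card_ord -[leLHS]mulr_natl ler_wpM2l ?ler0n //; lra.
have s1 : \sum_(j < n) (if (j < N0)%N then \sum_(k < n) D j k else 0) <=
    N0%:R * (3 * B).
  by rewrite -few; apply: ler_sum => j _; case: ifP.
have s2 : \sum_(k < n) (if (k < N0)%N then \sum_(j < n) D j k else 0) <=
    N0%:R * (3 * B).
  by rewrite -few; apply: ler_sum => k _; case: ifP.
have : N0%:R * (3 * B) * 2 <= n%:R * (eps / 2).
  by rewrite -ler_pdivrMr // divr_gt0.
by move: s1 s2 sG; lra.
Qed.

End Comparison.

(** * Location of the spectra *)

Section Norms.
Context {R : realType}.

Lemma vnorm2_sqr n (v : 'cV[R[i]]_n) : (vnorm2 v ^+ 2)%:C = sqn v^T.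
Proof.
rewrite /vnorm2 sqr_sqrtr; last by apply: sumr_ge0 => i _; rewrite sqr_ge0.
rewrite rmorph_sum; apply: eq_bigr => i _.
by rewrite mxE normCE rmorphXn.
Qed.

Lemma vnorm2_ge0 n (v : 'cV[R[i]]_n) : 0 <= vnorm2 v.
Proof. exact: sqrtr_ge0. Qed.

(** The supremum is that of a bounded set, since every matrix has some finite
    operator bound; column vectors are transposed to use it. *)
Lemma le_spectral_norm n (X : 'M[R[i]]_n) (v : 'cV[R[i]]_n) :
  vnorm2 v = 1 -> vnorm2 (X *m v) <= spectral_norm X.
Proof.
move=> v1; apply: ub_le_sup; last by exists v.
have [c /[dup] c0 /ger0_real /complex_realP [k ->] Xc] := opnorm_sq_le_ex X^T.
exists (Num.max 1 k) => _ [w w1 <-].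
have : vnorm2 (X *m w) ^+ 2 <= k.
  rewrite -lecR vnorm2_sqr trmx_mul; apply: le_trans (Xc _) _.
  by rewrite -vnorm2_sqr w1 expr1n mulr1.
case: (lerP (vnorm2 (X *m w)) 1) => [h _|h hk]; first by rewrite le_max h.
rewrite le_max; apply/orP; right; apply: le_trans hk.
by rewrite expr2 ler_peMl ?vnorm2_ge0 // ltW.
Qed.

Lemma abs_circulant_spectral n (d : 'rV[R[i]]_n) : (0 < n)%N ->
  let U := fourier_mx R n in
  abs_circulant (U ^t* *m diag_mx d *m U) = U ^t* *m diag_mx (\row_i `|d 0 i|) *m U.
Proof.
move=> n0 U; rewrite /abs_circulant -/U.
have uU := unitarymxP (fourier_mx_unitary (R := R) n0).
have -> : U *m (U ^t* *m diag_mx d *m U) *m U ^t* = diag_mx d.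
  by rewrite !mulmxA uU mul1mx -mulmxA uU mulmx1.
have -> // : map_mx (fun z : R[i] => `|z|) (diag_mx d) = diag_mx (\row_i `|d 0 i|).
apply/matrixP => i j; rewrite !mxE.
by have [->|ij] := eqVneq i j; rewrite ?mulr1n // mulr0n normr0.
Qed.

(** The columns of P^* are unit eigenvectors. *)
Lemma inv_spectral_norm_ge n (P : 'M[R[i]]_n) (d : 'rV_n) c : P \is unitarymx ->
  spectral_norm (P ^t* *m diag_mx d *m P) < c -> forall i, normc (d 0 i) <= c.
Proof.
move=> uP dc i; pose v := (row i P) ^t*.
have v1 : vnorm2 v = 1.
  apply/eqP; rewrite -(@eqrXn2 _ 2) ?vnorm2_ge0 // expr1n.
  apply/eqP/complexI; rewrite vnorm2_sqr.
  transitivity (sqn (row i P)); last by rewrite sqn_row_unitary.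
  by apply: eq_bigr => j _; rewrite !mxE norm_conjC.
have vX : P ^t* *m diag_mx d *m P *m v = d 0 i *: v.
  rewrite -!mulmxA.
  rewrite unitary_mul_row_adj //.
  have -> : diag_mx d *m (row i 1%:M) ^t* =
      d 0 i *: (row i (1%:M : 'M[R[i]]_n)) ^t*.
    apply/matrixP => j k; rewrite mul_diag_mx !mxE.
    by have [->|ij] := eqVneq i j; rewrite // mulr0n conjC0 !mulr0.
  by rewrite -scalemxAr -map_mxM -trmx_mul -row_mul mul1mx.
apply: le_trans (ltW dc); apply: le_trans (le_spectral_norm _ v1).
rewrite vX le_eqVlt; apply/orP; left.
rewrite -(@eqrXn2 _ 2) ?vnorm2_ge0 ?normc_ge0 //.
apply/eqP/complexI; rewrite vnorm2_sqr linearZ sqnZ -vnorm2_sqr v1 expr1n mulr1.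
by rewrite normCE rmorphXn.
Qed.

End Norms.

Section Spectra.
Context {R : realType} (f : R -> R).
Context (cf : continuous f).
Context (f_ge0 : forall x, 0 <= f x).
Context (f_summable : summable [set: int] (fun k => (normc (fourier f k))%:E)).

Lemma zero_in_I : (0 : R) \in (`[- pi, pi]%classic : set R).
Proof. by rewrite mem_setE in_itv /=; have := pi_gt0 R; lra. Qed.

Lemma fmax_ge0 : 0 <= fmax f.
Proof. exact: le_trans (f_ge0 0) (le_fmax cf zero_in_I). Qed.

Lemma toeplitz_unit_rayleigh n (v : 'rV[R[i]]_n) : sqn v = 1 ->
  0 <= (v *m toeplitz f n *m v ^t*) 0 0 <= (fmax f)%:C.
Proof.
move=> v1; have := @toeplitz_rayleigh _ f n v (fmax f) cf.
rewrite v1 mulr1; apply => x xI; by rewrite f_ge0 le_fmax.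
Qed.

Lemma toeplitz_spectral n : exists (P : 'M[R[i]]_n) (d : 'rV_n),
  [/\ P \is unitarymx, toeplitz f n = P ^t* *m diag_mx d *m P,
      (forall i, d 0 i \is Num.real) & forall i, normc (d 0 i) <= fmax f].
Proof.
have [P [d [uP AE dr]]] := hermitian_spectral (toeplitz_hermitian n cf).
exists P, d; split => // i.
have := toeplitz_unit_rayleigh (sqn_row_unitary i uP).
rewrite AE spectral_rayleigh // => /andP[d0 dM].
by rewrite -lecR -normCE ger0_norm.
Qed.

Lemma strang_eig_real n : (0 < n)%N -> forall i, strang_eig f n 0 i \is Num.real.
Proof.
move=> n0; apply: (hermitian_spectral_real (fourier_mx_unitary n0)).
by rewrite -(strang_eigen f n0) strang_hermitian.
Qed.

(** With v the i-th row of the Fourier matrix, the eigenvalue is v S v^*, hence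
    v A v^* - v (A - S) v^*.  The first term lies in [0, fmax f]; all |v_j| being
    n^(-1/2), the second one is at most the mean absolute row sum of A - S. *)
Lemma strang_eig_le (rho : R) : fmax f < rho ->
  exists N : nat, forall n, (N < n)%N -> forall i, normc (strang_eig f n 0 i) <= rho.
Proof.
move=> lt_rho; have e0 : 0 < rho - fmax f by rewrite subr_gt0.
have [N NP] := diff_total_sum f_summable e0.
exists N => n nN i; have n0 : (0 < n)%N by lia.
have nR : 0 < n%:R :> R by rewrite ltr0n.
set U := fourier_mx R n; have uU : U \is unitarymx := fourier_mx_unitary n0.
pose v := row i U; set D := toeplitz f n - strang f n.
have lamE : strang_eig f n 0 i =
    (v *m toeplitz f n *m v ^t*) 0 0 - (v *m D *m v ^t*) 0 0.
  rewrite -(spectral_rayleigh (strang_eig f n) i uU) -(strang_eigen f n0).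
  rewrite /D mulmxBr mulmxBl [X in _ - X]mxE opprD addrA subrr sub0r.
  by rewrite [X in - X]mxE opprK.
have vE j : normc (v 0 j) = (Num.sqrt n%:R)^-1.
  rewrite !mxE normcM normc_expi mulr1; apply: complexI.
  by rewrite -normCE ger0_norm // ler0c invr_ge0 sqrtr_ge0.
have vD : normc ((v *m D *m v ^t*) 0 0) <= rho - fmax f.
  rewrite -lecR -normCE mxE; apply: le_trans (ler_norm_sum _ _ _) _.
  apply: (@le_trans _ _ (\sum_(k < n) \sum_(j < n) (n%:R^-1 * normc (D j k))%:C)).
    apply: ler_sum => k _; rewrite normrM.
    have -> : `|(v ^t*) k 0| = (normc (v 0 k))%:C.
      by rewrite mxE mxE norm_conjC normCE.
    rewrite [(v *m D) 0 k]mxE vE.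
    apply: (@le_trans _ _ ((\sum_j `|v 0 j * D j k|) * ((Num.sqrt n%:R)^-1)%:C)).
      by rewrite ler_wpM2r ?ler_norm_sum // ler0c invr_ge0 sqrtr_ge0.
    rewrite mulr_suml; apply: ler_sum => j _.
    rewrite normrM !normCE vE -!rmorphM lecR mulrAC -invfM -expr2.
    by rewrite sqr_sqrtr ?ler0n.
  rewrite exchange_big.
  rewrite (_ : \sum_(j < n) _ = (n%:R^-1 * \sum_j \sum_k normc (D j k))%:C).
    by rewrite lecR mulrC ler_pdivrMr //; exact: NP.
  rewrite mulr_sumr rmorph_sum; apply: eq_bigr => j _.
  by rewrite mulr_sumr rmorph_sum.
have /andP[a0 aM] := toeplitz_unit_rayleigh (sqn_row_unitary i uU).
rewrite lamE; apply: le_trans (le_normcB _ _) _.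
have : normc ((v *m toeplitz f n *m v ^t*) 0 0) <= fmax f.
  by rewrite -lecR -normCE ger0_norm.
by lra.
Qed.

End Spectra.

(** * Clustering of the preconditioned spectrum *)

Section MatrixFunctions.
Context {R : realType}.

Lemma expr_small (B q eps : R) : 0 <= B -> 0 <= q -> q < 1 -> 0 < eps ->
  exists K : nat, B * q ^+ K <= eps.
Proof.
move=> B0 q0 q1 e0.
have cv : (fun n => B * q ^+ n) @ \oo --> B * 0.
  by apply: cvgMl_tmp; apply: cvg_expr; rewrite ger0_norm.
rewrite mulr0 in cv.
have /cvgrPdist_le /(_ _ e0) [K _ KP] := cv.
exists K; have := KP K (leqnn K); rewrite /= sub0r normrN.
by rewrite ger0_norm // mulr_ge0 // exprn_ge0.
Qed.

Definition real_spectrum_le (rho : R) (X : forall n, 'M[R[i]]_n) :=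
  exists N : nat, forall n, (N < n)%N -> exists (P : 'M[R[i]]_n) (d : 'rV_n),
    [/\ P \is unitarymx, X n = P ^t* *m diag_mx d *m P,
      (forall i, d 0 i \is Num.real) & forall i, normc (d 0 i) <= rho].

Lemma bounded_real_spectrum rho X :
  0 <= rho -> real_spectrum_le rho X -> opnorm_bounded X.
Proof.
move=> rho0 [N XN]; exists (rho ^+ 2)%:C, N; split=> [|n /XN [P [d [uP -> _ dr]]]].
  by rewrite ler0c exprn_ge0.
apply: opnorm_sq_le_spectral => // i; rewrite normCE -rmorphXn lecR.
by rewrite lerXn2r ?nnegrE ?normc_ge0.
Qed.

Lemma matfun_sub_psum h a (r : \bar R) rho X : power_series_on h a r ->
  0 <= rho -> (rho%:E < r)%E -> real_spectrum_le rho X ->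
  exists B q : R, [/\ 0 <= B, 0 <= q, q < 1 &
    exists N : nat, forall n K, (N < n)%N ->
    opnorm_sq_le (matfun a (X n) - \sum_(k < K) a k *: X n ^+ k)
      ((B * q ^+ K) ^+ 2)%:C].
Proof.
move=> hs rho0 ltr [N XN]; have [rho' lt_rho ltr'] := exists_between_EFin ltr.
have [B [q [B0 q0 q1 tail]]] := power_series_tail hs rho0 lt_rho ltr'.
exists B, q; split => //; exists N => n K /XN [P [d [uP -> dr dle]]].
apply: (opnorm_sq_le_matfun_psum hs) => // i; last exact: tail.
by apply: le_lt_trans ltr; rewrite lee_fin.
Qed.

Lemma bounded_matfun h a (r : \bar R) rho X : power_series_on h a r ->
  0 <= rho -> (rho%:E < r)%E -> real_spectrum_le rho X ->
  opnorm_bounded (fun n => matfun a (X n)).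
Proof.
move=> hs rho0 ltr sX.
have [B [q [B0 q0 q1 [N HN]]]] := matfun_sub_psum hs rho0 ltr sX.
exists (B ^+ 2)%:C, N; split=> [|n nN]; first by rewrite ler0c exprn_ge0.
by have := HN n 0%N nN; rewrite big_ord0 subr0 expr0 mulr1.
Qed.

(** Compare with a Taylor polynomial of degree high enough for both families;
    for polynomials the claim is [esmall_sub_poly]. *)
Lemma esmall_matfun_sub h a (r : \bar R) rho X Y : power_series_on h a r ->
  0 <= rho -> (rho%:E < r)%E -> real_spectrum_le rho X -> real_spectrum_le rho Y ->
  essentially_small (fun n => X n - Y n) ->
  essentially_small (fun n => matfun a (X n) - matfun a (Y n)).
Proof.
move=> hs rho0 ltr sX sY XY; apply: esmall_approx.
move=> _ /[dup] /gtr0_real /complex_realP [eps ->]; rewrite ltcR => e0.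
have [B1 [q1 [B10 q10 q11 [N1 H1]]]] := matfun_sub_psum hs rho0 ltr sX.
have [B2 [q2 [B20 q20 q21 [N2 H2]]]] := matfun_sub_psum hs rho0 ltr sY.
pose delta := Num.min 1 (eps / 4).
have d0 : 0 < delta by rewrite lt_min ltr01 /= divr_gt0 // ltr0n.
have dE : delta ^+ 2 <= eps / 4.
  have d1 : delta <= 1 by rewrite /delta ge_min lexx.
  have d2 : delta <= eps / 4 by rewrite /delta ge_min lexx orbT.
  by rewrite expr2 -[leRHS]mul1r ler_pM // ltW.
have [K1 K1P] := expr_small B10 q10 q11 d0.
have [K2 K2P] := expr_small B20 q20 q21 d0.
pose K := maxn K1 K2.
have le_K (B q : R) K' : 0 <= B -> 0 <= q -> q < 1 -> (K' <= K)%N ->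
    B * q ^+ K' <= delta -> (B * q ^+ K) ^+ 2 <= eps / 4.
  move=> B0 q0 ql KK hd; apply: le_trans dE.
  rewrite lerXn2r ?nnegrE ?mulr_ge0 ?exprn_ge0 ?(ltW d0) //.
  by apply: le_trans hd; rewrite ler_wpM2l // ler_wiXn2l // ltW.
exists (fun n => \sum_(k < K) a k *: X n ^+ k - \sum_(k < K) a k *: Y n ^+ k).
split.
  exact: esmall_sub_poly (bounded_real_spectrum rho0 sX)
    (bounded_real_spectrum rho0 sY) XY.
exists (maxn N1 N2) => n; rewrite gtn_max => /andP[n1 n2].
have := opnorm_sq_leD (H1 n K n1) (opnorm_sq_leN (H2 n K n2)).
have -> : forall S T S' T' : 'M[R[i]]_n, S - S' - (T - T') = S - T - (S' - T').
  by move=> S T S' T'; rewrite !opprD !opprK !addrA [S - S' - T]addrAC.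
apply: opnorm_sq_leW; rewrite -[2](rmorph_nat (real_complex R)) -rmorphD -rmorphM lecR.
have := le_K B1 q1 K1 B10 q10 q11 (leq_maxl _ _) K1P.
have := le_K B2 q2 K2 B20 q20 q21 (leq_maxr _ _) K2P.
by lra.
Qed.

End MatrixFunctions.

Section Preconditioning.
Context {R : realType}.

Lemma num_outliers_similar eps n (P A B : 'M[R[i]]_n) : P \in unitmx ->
  A *m P = P *m B -> num_outliers eps A = num_outliers eps B.
Proof.
by move=> uP AB; rewrite /num_outliers /eigenvalues (char_poly_similar uP AB).
Qed.

(** G G T and G T G are conjugate by G, and the outliers are read off the
    characteristic polynomial. *)
Lemma num_outliers_symmetrized eps n (G T : 'M[R[i]]_n) : G \in unitmx ->
  num_outliers eps (G *m G *m T) = num_outliers eps (G *m T *m G).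
Proof. by move=> uG; apply: (num_outliers_similar _ uG); rewrite !mulmxA. Qed.

(** With H = G B G and Q = G T G, where Q^2 = 1, the matrix
    H^2 - 1 = H (H - Q) + (H - Q) Q is essentially small because
    H - Q = G (B - T) G is. *)
Lemma scaled_outliers (B T G : forall n, 'M[R[i]]_n) (N0 : nat) :
  opnorm_bounded B -> opnorm_bounded T -> opnorm_bounded G ->
  essentially_small (fun n => B n - T n) ->
  (forall n, (N0 < n)%N -> [/\ (B n) ^t* = B n, (G n) ^t* = G n &
     (G n *m T n *m G n) *m (G n *m T n *m G n) = 1%:M]) ->
  forall eps : R, 0 < eps -> exists M N : nat, forall n, (N < n)%N ->
    (num_outliers eps (G n *m B n *m G n)%R <= M)%N.
Proof.
move=> bB bT bG BT GH eps e0.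
pose H n := G n *m B n *m G n; pose Q n := G n *m T n *m G n.
have HQ : essentially_small (fun n => H n - Q n).
  apply: (@esmall_eq _ _ _ 0%N _ (esmallMr bG (esmallMl bG BT))) => n _.
  by rewrite /H /Q mulmxBr mulmxBl.
have bH : opnorm_bounded H := boundedM (boundedM bG bB) bG.
have bQ : opnorm_bounded Q := boundedM (boundedM bG bT) bG.
have HH : essentially_small (fun n => H n *m H n - 1%:M).
  apply: (@esmall_eq _ _ _ N0 _ (esmallD (esmallMl bH HQ) (esmallMr bQ HQ))).
  move=> n /GH [_ _ Q1].
  rewrite mulmxBr mulmxBl -[Q n *m Q n]/((G n *m T n *m G n) *m _) Q1.
  by rewrite addrA subrK.
have eC : 0 < eps%:C :> R[i] by rewrite ltcR.
have [M [N MN]] := outliers_of_essentially_small HH eC.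
exists M, (maxn N0 N) => n; rewrite gtn_max => /andP[n0 nN].
have [hB hG _] := GH n n0.
have hH : (H n) ^t* = H n by rewrite /H !trmx_mul !map_mxM hB hG mulmxA.
have [P [d [uP HE _]]] := hermitian_spectral hH.
rewrite -/(H n) HE num_outliers_spectral //; exact: (MN n nN P d uP HE).
Qed.

Lemma normc_gt0 (z : R[i]) : (0 < normc z) = (z != 0).
Proof. by rewrite -ltcR -normCE normr_gt0. Qed.

Lemma real_sqr_norm (z : R[i]) : z \is Num.real -> z * z = (normc z ^+ 2)%:C.
Proof. by move=> zr; rewrite rmorphXn /= -normCE real_normK // expr2. Qed.

(** This is |C|^(-1/2) for the circulant C with eigenvalues m_i. *)
Definition inv_sqrt_abs n (m : 'rV[R[i]]_n) : 'M[R[i]]_n :=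
  let U := fourier_mx R n in
  U ^t* *m diag_mx (\row_i ((Num.sqrt (normc (m 0 i)))^-1)%:C) *m U.

Lemma inv_sqrt_sqr (x : R) : 0 <= x ->
  ((Num.sqrt x)^-1)%:C * ((Num.sqrt x)^-1)%:C = (x^-1)%:C :> R[i].
Proof. by move=> x0; rewrite -rmorphM /= -invfM -expr2 sqr_sqrtr. Qed.

Lemma inv_sqrt_abs_hermitian n (m : 'rV[R[i]]_n) :
  (inv_sqrt_abs m) ^t* = inv_sqrt_abs m.
Proof.
apply: spectral_hermitian => i; rewrite mxE.
by apply/complex_realP; eexists.
Qed.

Lemma opnorm_sq_le_inv_sqrt_abs n (m : 'rV[R[i]]_n) c : (0 < n)%N ->
  (forall i, (normc (m 0 i))^-1 <= c) -> opnorm_sq_le (inv_sqrt_abs m) c%:C.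
Proof.
move=> n0 mc; apply: opnorm_sq_le_spectral => [|i].
  exact: fourier_mx_unitary.
rewrite mxE ger0_norm ?ler0c ?invr_ge0 ?sqrtr_ge0 //.
by rewrite expr2 inv_sqrt_sqr ?normc_ge0 // lecR.
Qed.

Lemma inv_sqrt_abs_unit n (m : 'rV[R[i]]_n) : (0 < n)%N ->
  (forall i, m 0 i != 0) -> inv_sqrt_abs m \in unitmx.
Proof.
move=> n0 m0; have uU := fourier_mx_unitary (R := R) n0.
suff g0 i : (\row_i ((Num.sqrt (normc (m 0 i)))^-1)%:C : 'rV[R[i]]_n) 0 i != 0.
  by have [] := spectral_inv uU g0.
by rewrite mxE fmorph_eq0 invr_eq0 gt_eqF // sqrtr_gt0 normc_gt0.
Qed.

Lemma inv_abs_circulant n (m : 'rV[R[i]]_n) : (0 < n)%N ->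
  (forall i, m 0 i != 0) -> let U := fourier_mx R n in
  invmx (abs_circulant (U ^t* *m diag_mx m *m U)) =
    inv_sqrt_abs m *m inv_sqrt_abs m.
Proof.
move=> n0 m0 U; have uU : U \is unitarymx := fourier_mx_unitary n0.
have abs0 i : (\row_i `|m 0 i|) 0 i != 0 by rewrite mxE normr_eq0.
rewrite abs_circulant_spectral //; have [_ ->] := spectral_inv uU abs0.
rewrite mul_spectral //; apply: eq_spectral.
by apply/rowP => i; rewrite !mxE inv_sqrt_sqr ?normc_ge0 // normCE fmorphV.
Qed.

(** Each eigenvalue of Q is m_i / |m_i|, a sign since m_i is real. *)
Lemma inv_sqrt_abs_sign n (m : 'rV[R[i]]_n) : (0 < n)%N ->
  (forall i, m 0 i \is Num.real) -> (forall i, m 0 i != 0) ->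
  let U := fourier_mx R n in let G := inv_sqrt_abs m in
  let Q := G *m (U ^t* *m diag_mx m *m U) *m G in Q *m Q = 1%:M.
Proof.
move=> n0 mr m0 U G Q; have uU : U \is unitarymx := fourier_mx_unitary n0.
rewrite /Q /G /inv_sqrt_abs !mul_spectral // -(one_spectral uU).
apply: eq_spectral; apply/rowP => i; rewrite !mxE.
set g := _%:C.
have -> : g * m 0 i * g * (g * m 0 i * g) =
    (g * g) * (g * g) * (m 0 i * m 0 i) by ring.
rewrite inv_sqrt_sqr ?normc_ge0 // real_sqr_norm // -!rmorphM /=.
by rewrite -invfM -expr2 mulVf // expf_neq0 // gt_eqF // normc_gt0.
Qed.

End Preconditioning.

Theorem corollary3p8 (R : realType) (h : R[i] -> R[i]) (a : nat -> R[i])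
  (r : \bar R) (f : R -> R)
  (r_gt0 : (0 < r)%E)
  (h_series : power_series_on h a r)
  (a_radius : convergence_radius a = r)
  (a_real : forall k : nat, a k \is Num.real)
  (f_wiener : wiener f)
  (f_pos : forall x : R, 0 < f x)
  (fmax_lt_r : ((fmax f)%:E < r)%E)
  (h_inv_bounded : exists c0 : R, forall n : nat, (0 < n)%N ->
     ((spectral_radius (strang f n))%:E < r)%E ->
     matfun a (strang f n) \in unitmx /\
     spectral_norm (invmx (matfun a (strang f n))) < c0) :
  forall eps : R, 0 < eps ->
  exists M N : nat, [/\ (0 < M)%N, (0 < N)%N &
    forall n : nat, (N < n)%N ->
    [/\ ((spectral_radius (strang f n))%:E < r)%E,
        ((spectral_radius (toeplitz f n))%:E < r)%E &
        (num_outliers eps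
           (invmx (abs_circulant (matfun a (strang f n))) *m
            matfun a (toeplitz f n))%R <= M)%N]].
Proof.
move=> eps e0; have [cf _ sf] := f_wiener.
have f0 x : 0 <= f x by exact: ltW.
have [rho lt_rho ltr] := exists_between_EFin fmax_lt_r.
have rho0 : 0 <= rho by apply: le_trans (ltW lt_rho); exact: fmax_ge0.
have in_disc (x : R) : x <= rho -> (x%:E < r)%E.
  by move=> xr; apply: le_lt_trans ltr; rewrite lee_fin.
have specA : real_spectrum_le rho (fun n => toeplitz f n).
  exists 0%N => n _; have [P [d [uP AE dr dle]]] := toeplitz_spectral cf f0 n.
  by exists P, d; split => // i; apply: le_trans (ltW lt_rho).
have [NS lamP] := strang_eig_le cf f0 sf lt_rho.
pose U n := fourier_mx R n; pose lam n := strang_eig f n.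
have uU n : (0 < n)%N -> U n \is unitarymx := @fourier_mx_unitary R n.
have SE n : (0 < n)%N -> strang f n = (U n) ^t* *m diag_mx (lam n) *m U n.
  exact: strang_eigen.
have specS : real_spectrum_le rho (fun n => strang f n).
  exists NS => n nN; have n0 : (0 < n)%N by lia.
  exists (U n), (lam n); split;
    [exact: uU | exact: SE | exact: strang_eig_real | exact: lamP].
pose mu n i := h (lam n 0 i).
have muE n : (NS < n)%N ->
    matfun a (strang f n) = (U n) ^t* *m diag_mx (\row_i mu n i) *m U n.
  move=> nN; have n0 : (0 < n)%N by lia.
  rewrite SE // (matfun_spectral h_series) ?uU // => i.
  by apply: in_disc; exact: lamP.
have mu_real n i : (NS < n)%N -> mu n i \is Num.real.
  move=> nN; apply: (power_series_real h_series a_real).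
    by apply: strang_eig_real => //; lia.
  by apply: in_disc; exact: lamP.
have radS n : (NS < n)%N -> ((spectral_radius (strang f n))%:E < r)%E.
  move=> nN; have n0 : (0 < n)%N by lia.
  by apply: in_disc; rewrite SE // spectral_radius_spectral ?uU //; exact: lamP.
have radA n : ((spectral_radius (toeplitz f n))%:E < r)%E.
  have [P [d [uP -> _ dle]]] := toeplitz_spectral cf f0 n.
  apply: in_disc; apply: spectral_radius_spectral => // i.
  exact: le_trans (dle i) (ltW lt_rho).
have [c0 c0P] := h_inv_bounded.
have mu_neq0 n i : (NS < n)%N -> mu n i != 0.
  move=> nN; have n0 : (0 < n)%N by lia.
  have [] := c0P n n0 (radS n nN); rewrite muE // => uh _.
  by have := unit_spectral_neq0 (uU n n0) uh i; rewrite mxE.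
(* The norm of h(S)^(-1) dominates the moduli of its eigenvalues. *)
have mu_inv n i : (NS < n)%N -> (normc (mu n i))^-1 <= c0.
  move=> nN; have n0 : (0 < n)%N by lia.
  have [_] := c0P n n0 (radS n nN); rewrite muE //.
  have d0 j : (\row_i mu n i) 0 j != 0 by rewrite mxE mu_neq0.
  have [_ ->] := spectral_inv (uU n n0) d0.
  by move/(inv_spectral_norm_ge (uU n n0))/(_ i); rewrite !mxE normcV.
pose G n := inv_sqrt_abs (\row_i mu n i).
have c00 : 0 <= c0.
  have := mu_inv NS.+1 ord0 (ltnSn _); apply: le_trans.
  by rewrite invr_ge0 normc_ge0.
have bG : opnorm_bounded G.
  exists c0%:C, NS; split=> [|n nN]; first by rewrite ler0c.
  have n0 : (0 < n)%N by lia.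
  by apply: opnorm_sq_le_inv_sqrt_abs => // i; rewrite mxE mu_inv.
have BT := esmall_matfun_sub h_series rho0 ltr specA specS
  (toeplitz_strang_essentially_small sf).
have key n : (NS < n)%N ->
    [/\ (matfun a (toeplitz f n)) ^t* = matfun a (toeplitz f n),
    (G n) ^t* = G n &
    (G n *m matfun a (strang f n) *m G n) *m
    (G n *m matfun a (strang f n) *m G n) = 1%:M].
  move=> nN; have n0 : (0 < n)%N by lia.
  split; last 1 first.
  - rewrite (muE n nN); apply: inv_sqrt_abs_sign => // i;
      by rewrite mxE ?mu_real ?mu_neq0.
  - have [P [d [uP -> dr dle]]] := toeplitz_spectral cf f0 n.
    have dd i : ((normc (d 0 i))%:E < r)%E.
      by apply: in_disc; exact: le_trans (dle i) (ltW lt_rho).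
    rewrite (matfun_spectral h_series uP dd); apply: spectral_hermitian => i.
    by rewrite mxE; exact: (power_series_real h_series a_real (dr i) (dd i)).
  - exact: inv_sqrt_abs_hermitian.
have [M [N MN]] := scaled_outliers (bounded_matfun h_series rho0 ltr specA)
  (bounded_matfun h_series rho0 ltr specS) bG BT key e0.
exists M.+1, (maxn NS N).+1; split=> // n nN.
have n1 : (NS < n)%N by lia.
have n2 : (N < n)%N by lia.
have n0 : (0 < n)%N by lia.
split; [exact: radS | exact: radA |].
have m0 i : (\row_i mu n i) 0 i != 0 by rewrite mxE mu_neq0.
rewrite (muE n n1) (inv_abs_circulant n0 m0).
rewrite (num_outliers_symmetrized _ _ (inv_sqrt_abs_unit n0 m0)).
exact: leq_trans (MN n n2) (leqnSn M).
Qed.
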